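(* For every $D<\infty$ there exists a constant $C=C(D)$ such that for every connected infinite penny graph $G=(V,E,F)$ with $\deg(\sigma)\le D$ for all $\sigma\in F$, $$\dim\mathcal{H}^k(G)\le Ck^2,\qquad\forall k\ge1.$$
   Context: Penny graphs: Let $\{B_i\}_{i=1}^\infty$ be a collection of pairwise disjoint open disks of radius $\frac12$ in $\mathbb{R}^2$, with boundary circles $C_i$ and centers $c_i$. Let $V=\{v_i\}_{i=1}^\infty$, and let $\{v_i,v_j\}\in E$ ($i\ne j$) iff $C_i$ and $C_j$ are tangent, i.e. $|c_i-c_j|=1$. The embedding $\phi$ is given by $\phi(v_i)=c_i$, $\phi(\{v_i,v_j\})=\overline{c_ic_j}$ (the straight segment). The set $F$ of faces corresponds to the connected components of the complement in $\mathbb{R}^2$ of the embedded image of $(V,E)$; for $\sigma\in F$, $\phi(\sigma)$ denotes the corresponding component. The facial degree $\deg(\sigma)\in\mathbb{N}\cup\{\infty\}$ is the number of interior angles (corners at embedded vertices, counted with multiplicity) of the polygonal domain $\phi(\sigma)$. The triple $G=(V,E,F)$ is called an infinite penny graph; it is connected if the graph $(V,E)$ is connected. $d$ is the combinatorial (shortest path) distance on $(V,E)$; $\Delta u(x)=\sum_{y\sim x}(u(y)-u(x))$ for $u:V\to\mathbb{R}$, the sum being over neighbors $y$ of $x$. Fix $x_0\in V$. For real $k\ge0$, $\mathcal{H}^k(G)$ is the real vector space of functions $u:V\to\mathbb{R}$ with $\Delta u=0$ on $V$ for which there is a constant $C_u$ (depending on $u$) with $|u(x)|\le C_u(1+d(x,x_0))^k$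 for all $x\in V$. This space does not depend on the choice of $x_0$. *)

(* Defs.v *)
From HB Require Import structures.
From mathcomp Require Import all_boot all_order all_algebra.
From mathcomp Require Import all_classical all_reals all_analysis.
Set Implicit Arguments.
Unset Strict Implicit.
Unset Printing Implicit Defensive.
Import Order.TTheory GRing.Theory Num.Theory.
Import numFieldNormedType.Exports.
Local Open Scope classical_set_scope.
Local Open Scope ring_scope.

(* The plane is R * R with its product topology. The library norm on R * R is
   the sup norm, so the Euclidean distance is defined here. *)
Definition edist (R : realType) (p q : R * R) : R :=
  Num.sqrt ((p.1 - q.1) ^+ 2 + (p.2 - q.2) ^+ 2).

Definition open_disk (R : realType) (p : R * R) (r : R) : set (R * R) :=
  [set q | edist q p < r].

Definition segment (R : realType) (p q : R * R) : set (R * R) :=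
  [set (line_path p.1 q.1 t, line_path p.2 q.2 t) | t in `[0, 1]].

Definition components (T : topologicalType) (A : set T) : set (set T) :=
  [set connected_component A x | x in A].

(* The vertex v_i is represented by its index i : nat, so V = nat; the edges
   and the faces are determined by the centers. *)
Record penny_graph (R : realType) := PennyGraph {
  center : nat -> R * R;
  disks_disjoint : trivIset [set: nat] (fun i => open_disk (center i) 2^-1)
}.

Definition adj (R : realType) (G : penny_graph R) : rel nat :=
  fun i j => (i != j) && (edist (center G i) (center G j) == 1).

Definition embedded_image (R : realType) (G : penny_graph R) : set (R * R) :=
  [set p | (exists i, p = center G i) \/
           exists i j, adj G i j /\ segment (center G i) (center G j) p].

Definition faces (R : realType) (G : penny_graph R) : set (set (R * R)) :=
  components (~` embedded_image G).

(* An edge not incident to v is at distance at least sqrt 3 / 2 > 1 / 2 from the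
   center of v. Hence the open disk of radius 1 / 2 about v meets the embedded
   graph only in the radii along the edges at v, and the components of the rest
   of the disk are the open sectors between cyclically consecutive edges at v
   (a single sector of angle 2 * pi if v has degree one). The interior angles of
   a face are the sectors it contains; a vertex visited several times by the
   boundary of the face contributes several sectors. *)
Definition corners (R : realType) (G : penny_graph R) (sigma : set (R * R)) :
    set (nat * set (R * R)) :=
  [set vS | components (open_disk (center G vS.1) 2^-1 `\` embedded_image G) vS.2
            /\ vS.2 `<=` sigma].

(* counting is the cardinality, with value +oo on infinite sets *)
Definition facial_degree (R : realType) (G : penny_graph R)
    (sigma : set (R * R)) : \bar R :=
  counting (corners G sigma).

Definition walk_length (R : realType) (G : penny_graph R) (x y n : nat) : Prop :=
  exists p : seq nat, [/\ path (adj G) x p, last x p = y & size p = n].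

Definition graph_connected (R : realType) (G : penny_graph R) : Prop :=
  forall x y : nat, exists n : nat, walk_length G x y n.

(* The value is 0 when there is no walk from x to y. *)
Definition graph_dist (R : realType) (G : penny_graph R) (x y : nat) : nat :=
  xget 0%N [set n | walk_length G x y n /\
                    forall m : nat, walk_length G x y m -> (n <= m)%N].

(* A finitely supported sum: a vertex of a penny graph has at most six
   neighbors. *)
Definition laplacian (R : realType) (G : penny_graph R) (u : nat -> R) (x : nat)
    : R :=
  \sum_(y \in [set y | adj G x y]) (u y - u x).

Definition harmonic_growth (R : realType) (G : penny_graph R) (x0 : nat) (k : R)
    : set (nat -> R) :=
  [set u | (forall x : nat, laplacian G u x = 0) /\
           exists C : R, forall x : nat,
             `|u x| <= C * (1 + (graph_dist G x x0)%:R) `^ k].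

Definition is_basis (R : realType) (T : Type) (W : set (T -> R)) (n : nat)
    (b : 'I_n -> T -> R) : Prop :=
  [/\ forall i, W (b i),
      forall a : 'I_n -> R,
        (forall x, \sum_(i < n) a i * b i x = 0) -> forall i, a i = 0
    & forall u, W u ->
        exists a : 'I_n -> R, forall x, u x = \sum_(i < n) a i * b i x].

(* For a linear subspace W: the common size of its finite bases, and +oo (the
   infimum of the empty set) when it has none. *)
Definition dimension (R : realType) (T : Type) (W : set (T -> R)) : \bar R :=
  ereal_inf [set (n%:R)%:E | n in [set n : nat |
    exists b : 'I_n -> T -> R, is_basis W b]].

(* Main.v *)
Require Import Defs.
From HB Require Import structures.
From mathcomp Require Import all_boot all_order all_algebra perm.
From mathcomp Require Import all_classical all_reals all_analysis.
From mathcomp Require Import lra ring.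
Import Order.TTheory GRing.Theory Num.Theory.
Import numFieldNormedType.Exports.
Local Open Scope classical_set_scope.
Local Open Scope ring_scope.

(* A bounded facial degree makes the graph roughly isometric to a planar
   lattice.  The boundary of a face lies within distance 1 of the boundedly many
   vertices that carry its corners, so some square of bounded size around one of
   them avoids this boundary; the graph, being infinite and connected, meets the
   square, hence the square misses the face and the face lies inside.  If two
   nearby vertices could not be joined inside a bounded box, a level set of the
   distance to the part of the graph reachable from the first one would contain
   a closed curve that avoids the graph and separates the two.

   The dimension is then bounded as by Colding and Minicozzi.  Let K be the
   integer growth exponent and cover a box of radius r by m = O(K^2) blocks of
   side comparable to r / K.  By the Poincare and Caccioppoli inequalities a
   harmonic function with zero mean on every block has at least delta^-1 times
   as much L^2-mass in the box of radius (1 + 1/K) r as in that of radius r.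
   Hence passing from r to (1 + 1/K) r multiplies the Gram determinant of n
   independent functions by at least delta^-(n - m), while the polynomial growth
   allows a factor X^n on average, with X = e^4.  The choice delta = X^-2 gives
   n <= 2 m. *)

Set Implicit Arguments.
Unset Strict Implicit.
Unset Printing Implicit Defensive.

(** * Topology of the plane *)

(** Why the contraction can be made as strong as desired: Poincare on blocks of h lattice points a
    side costs h^2, Caccioppoli with a cut-off of width g gains g^-2. Both h and g are proportional
    to r / K, and a factor 1 / c0 in the block side makes h / g at most 4 / c0 for all large r and
    all K. So m stays quadratic in K while c0, chosen from D alone, makes delta small.

    Poincare needs more than connectedness: the path joining two nearby vertices must stay in a box
    of bounded size, so that the energies charged to different lattice points overlap boundedly. The
    separating curve that would exclude such paths is never constructed. An indicator function is
    sampled on a fine lattice, its jumps form a cochain mod 2, and exactness of closed cochains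
    takes the place of the Jordan curve theorem. *)

Section Plane.
Variable R : realType.
Implicit Types (p q x y : R * R) (r : R) (A U : set (R * R)).

(* The closed ball of the library norm on R * R, which is the sup norm, spelled
   out as linear inequalities. *)
Definition box p r q : bool :=
  [&& p.1 - r <= q.1, q.1 <= p.1 + r, p.2 - r <= q.2 & q.2 <= p.2 + r].

Lemma box_norm p r q : box p r q = (`|q - p| <= r).
Proof.
by rewrite prod_normE ge_max /= !ler_distl /box -!andbA.
Qed.

Lemma nbhs_boxP x A :
  nbhs x A <-> exists2 e : R, 0 < e & forall y, box x e y -> A y.
Proof.
split.
  move=> /nbhs_ballP [e e0 H]; exists (e / 2); first by rewrite divr_gt0.
  move=> y; rewrite box_norm => h; apply: H.
  rewrite prod_norm_ball /ball_ /= distrC (le_lt_trans h) // ltr_pdivrMr //.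
  by rewrite ltr_pMr // ltr1n.
move=> [e e0 H]; apply/nbhs_ballP; exists e => // y.
rewrite prod_norm_ball /ball_ /= distrC => h; apply: H.
by rewrite box_norm ltW.
Qed.

Lemma line_path2_continuous p q :
  continuous (fun t : R => (line_path p.1 q.1 t, line_path p.2 q.2 t)).
Proof.
have H a b : continuous (line_path a b : R -> R).
  move=> t; apply: cvgD; apply: cvgM;
  by [exact: cvg_cst|exact: cvg_id|apply: cvgB; [exact: cvg_cst|exact: cvg_id]].
move=> t; apply: (@cvg_pair _ _ _ _ (nbhs (line_path p.1 q.1 t))
  (nbhs (line_path p.2 q.2 t))); exact: H.
Qed.

Lemma segment_connected_plane p q : connected (segment p q).
Proof.
apply: connected_continuous_connected; first exact: segment_connected.
by apply: continuous_subspaceT; exact: line_path2_continuous.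
Qed.

Lemma closed_segment p q : closed (segment p q).
Proof.
apply: compact_closed; first exact: norm_hausdorff.
apply: continuous_compact; last exact: segment_compact.
by apply: continuous_subspaceT; exact: line_path2_continuous.
Qed.

Lemma segment_left p q : segment p q p.
Proof.
exists 0; first by rewrite /= in_itv /= lexx ler01.
by rewrite /line_path !subr0 !mul1r !mul0r !addr0 -surjective_pairing.
Qed.

Lemma segment_right p q : segment p q q.
Proof.
exists 1; first by rewrite /= in_itv /= lexx ler01.
by rewrite /line_path !subrr !mul1r !mul0r !add0r -surjective_pairing.
Qed.

Lemma segment_component U x y :
  segment x y `<=` U -> connected_component U x y.
Proof.
move=> sU; apply: (connected_component_max (B := segment x y)) => //.
- exact: segment_left.
- exact: segment_connected_plane.
- exact: segment_right.
Qed.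

Lemma box_convex p r x y z :
  box p r x -> box p r y -> segment x y z -> box p r z.
Proof.
move=> /and4P[a1 a2 a3 a4] /and4P[b1 b2 b3 b4] [t /=]; rewrite in_itv /=.
move=> /andP[t0 t1] <-; rewrite /box /line_path /=.
by apply/and4P; split; nra.
Qed.

Lemma box_component U p r x y :
  (forall z, box p r z -> U z) -> box p r x -> box p r y ->
  connected_component U x y.
Proof.
move=> H bx by_; apply: segment_component => z /(box_convex bx by_).
exact: H.
Qed.

Lemma boxxx p r : 0 <= r -> box p r p.
Proof. by move=> r0; apply/and4P; split; lra. Qed.

Lemma component_open U b : open U -> open (connected_component U b).
Proof.
move=> oU; rewrite openE => x Ux; apply/nbhs_boxP.
have /nbhs_boxP[e e0 H] : nbhs x U.
  by apply: open_nbhs_nbhs; split => //; apply: connected_component_sub Ux.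
exists e => // y xy; apply: connected_component_trans Ux _.
by apply: box_component H _ xy; rewrite boxxx // ltW.
Qed.

Lemma closure_component U b x : open U -> U x ->
  closure (connected_component U b) x -> connected_component U b x.
Proof.
move=> oU Ux.
have /nbhs_boxP[e e0 H] : nbhs x U by apply: open_nbhs_nbhs; split.
move=> /(_ [set y | box x e y]) [].
  by apply/nbhs_boxP; exists e.
move=> y [Uy xy]; apply: connected_component_trans Uy _.
by apply: box_component H xy _; rewrite boxxx // ltW.
Qed.

(** The trace of the component on [C] is open in [C]. Without a boundary point in [A] it would also
    be closed in [C], hence all of [C], which meets [A]. *)
Lemma component_first_hit A C b : closed A -> connected C ->
  C `&` connected_component (~` A) b !=set0 -> C `&` A !=set0 ->
  exists a, [/\ C a, A a & closure (connected_component (~` A) b) a].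
Proof.
move=> cA cC CS [z [Cz Az]]; apply: contrapT => nh.
have oA : open (~` A) by apply: closed_openC.
suff E : C `&` connected_component (~` A) b = C.
  by have : C z by []; rewrite -E => -[_ /connected_component_sub].
apply: cC => //.
  by exists (connected_component (~` A) b) => //; apply: component_open.
exists (closure (connected_component (~` A) b)); first exact: closed_closure.
rewrite eqEsubset; split => x [Cx Sx]; split => //; first exact: subset_closure.
apply: closure_component => // Ax; apply: nh; by exists x.
Qed.

Definition sphere p r : set (R * R) := [set q | `|q - p| = r].

(** In the sup norm this is the boundary of a square: four segments, each meeting the next in a
    corner. *)
Lemma sphere_connected p r : 0 <= r -> connected (sphere p r).
Proof.
move=> r0.
pose a := (p.1 - r, p.2 - r); pose b := (p.1 + r, p.2 - r).
pose c := (p.1 + r, p.2 + r); pose d := (p.1 - r, p.2 + r).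
have -> : sphere p r =
  segment a b `|` (segment b c `|` (segment c d `|` segment d a)).
  have sub x : segment a b x \/ segment b c x \/ segment c d x \/ segment d a x
     -> sphere p r x.
    rewrite /sphere /= prod_normE /=.
    have tr t u v : 0 <= t <= 1 ->
        (u = r \/ u = - r) -> v = (1 - t) * (- r) + t * r \/
           v = (1 - t) * r + t * (- r) -> Num.max `|u| `|v| = r.
      move=> /andP[t0 t1] hu hv.
      have -> : `|u| = r by case: hu => ->; rewrite ?normrN ger0_norm.
      by apply/max_idPl; rewrite ler_norml; case: hv => ->; apply/andP; split; nra.
    case=> [|[|[]]] [t]; rewrite /= in_itv /= => ht <-; rewrite /line_path /=.
    - by rewrite maxC; apply: (tr t) => //; [right; ring|left; ring].
    - by apply: (tr t) => //; [left; ring|left; ring].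
    - by rewrite maxC; apply: (tr t) => //; [left; ring|right; ring].
    - by apply: (tr t) => //; [right; ring|right; ring].
  rewrite eqEsubset; split => x; last first.
    by move=> h; apply: sub; move: h => [|[|[]]]; tauto.
  rewrite /sphere /= => h.
  have : box p r x by rewrite box_norm h.
  move=> /and4P[h1 h2 h3 h4].
  have [r00|rn] := eqVneq r 0.
    left; have -> : x = a.
      by rewrite [x]surjective_pairing /a; congr (_, _); lra.
    exact: segment_left.
  have rp : 0 < 2 * r by rewrite mulr_gt0 // lt_def rn.
  have rr : r / (2 * r) = 2^-1 by field.
  have tt u : - r <= u <= r -> 0 <= (u + r) / (2 * r) <= 1.
    move=> /andP[u1 u2]; rewrite divr_ge0 ?(ltW rp) //=; last lra.
    by rewrite ler_pdivrMr // mul1r; lra.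
  move: h; rewrite prod_normE /= => h.
  have : `|x.1 - p.1| = r \/ `|x.2 - p.2| = r.
    by move: h; rewrite /Num.max; case: ifP => _; [right|left].
  have E1 u : u = (1 - (u + r) / (2 * r)) * (- r) + (u + r) / (2 * r) * r.
    by field.
  case=> hh.
    have [k1|k1] := eqVneq (x.1 - p.1) r.
      right; left; exists ((x.2 - p.2 + r) / (2 * r)).
        by rewrite /= in_itv /=; apply: tt; apply/andP; split; lra.
      rewrite [RHS]surjective_pairing /line_path /=; congr (_, _).
        by rewrite -mulrDl subrK mul1r; lra.
      by field.
    have k2 : x.1 - p.1 = - r.
      move: hh; case: (ler0P (x.1 - p.1)) => _ hh; first lra.
      by rewrite hh eqxx in k1.
    right; right; right; exists ((- (x.2 - p.2) + r) / (2 * r)).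
      by rewrite /= in_itv /=; apply: tt; apply/andP; split; lra.
    rewrite [RHS]surjective_pairing /line_path /=; congr (_, _).
      by rewrite -mulrDl subrK mul1r; lra.
    by field.
  have [k1|k1] := eqVneq (x.2 - p.2) r.
    right; right; left; exists ((- (x.1 - p.1) + r) / (2 * r)).
      by rewrite /= in_itv /=; apply: tt; apply/andP; split; lra.
    rewrite [RHS]surjective_pairing /line_path /=; congr (_, _); first by field.
    by rewrite -mulrDl subrK mul1r; lra.
  have k2 : x.2 - p.2 = - r.
    move: hh; case: (ler0P (x.2 - p.2)) => _ hh; first lra.
    by rewrite hh eqxx in k1.
  left; exists ((x.1 - p.1 + r) / (2 * r)).
    by rewrite /= in_itv /=; apply: tt; apply/andP; split; lra.
  rewrite [RHS]surjective_pairing /line_path /=; congr (_, _); first by field.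
  by rewrite -mulrDl subrK mul1r; lra.
apply: connectedU; [|exact: segment_connected_plane|].
  exists b; split; first exact: segment_right.
  by left; exact: segment_left.
apply: connectedU; [|exact: segment_connected_plane|].
  exists c; split; first exact: segment_right.
  by left; exact: segment_left.
apply: connectedU; [|exact: segment_connected_plane..].
exists d; split; first exact: segment_right.
exact: segment_left.
Qed.

Lemma connected_meets_sphere A p r x y : connected A -> A x -> A y ->
  `|x - p| <= r -> r <= `|y - p| -> A `&` sphere p r !=set0.
Proof.
move=> cA Ax Ay xr yr.
have : connected ((fun q => `|q - p|) @` A).
  apply: connected_continuous_connected => //.
  apply: continuous_subspaceT => q; apply: cvg_norm.
  by apply: cvgB; [exact: cvg_id|exact: cvg_cst].
move=> /connected_intervalP H.
have [|||z Az zr] // := H `|x - p| `|y - p| _ _ r.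
- by exists x.
- by exists y.
- by rewrite xr yr.
by exists z.
Qed.

End Plane.

(** * Geometry of penny graphs *)

Section Packing.
Variable R : realType.

(** Number of cells of side 1/2 that cover a box of radius [r]. *)
Definition packing (r : R) : nat := (Num.truncn (4 * r)).+1 ^ 2.

(** Two positions in one cell of side 1/2 would be too close, so the cell map is injective. [pos] is
    arbitrary because lattice points are counted this way as well as centers. *)
Lemma packing_bound (T : eqType) (pos : T -> R * R) (p : R * R) (r : R)
    (s : seq T) :
  (forall x y, x != y -> ~~ box (pos x) 2^-1 (pos y)) ->
  uniq s -> (forall x, x \in s -> box p r (pos x)) -> (size s <= packing r)%N.
Proof.
move=> sep us hs.
pose n := (Num.truncn (4 * r)).
pose f x : 'I_n.+1 * 'I_n.+1 :=
  (inord (Num.truncn (2 * ((pos x).1 - p.1 + r))),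
   inord (Num.truncn (2 * ((pos x).2 - p.2 + r)))).
have hlt (u : R) : 0 <= u -> u <= 4 * r -> (Num.truncn u < n.+1)%N.
  by move=> u0 u1; rewrite ltnS; apply: le_truncn.
have inj : {in s &, injective f}.
  move=> x y /hs /and4P[x1 x2 x3 x4] /hs /and4P[y1 y2 y3 y4] [].
  move=> /(congr1 (@nat_of_ord _)) e1 /(congr1 (@nat_of_ord _)) e2.
  apply/eqP; apply: contraT => /sep /negP h; exfalso; apply: h.
  move: e1 e2; rewrite !inordK; try by apply: hlt; lra.
  have H (u v : R) : 0 <= u -> 0 <= v -> Num.truncn u = Num.truncn v ->
      u < v + 1.
    move=> u0 v0 e; have /andP[_ h1] := truncn_itv u0.
    have /andP[h2 _] := truncn_itv v0; rewrite e in h1.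
    by apply: lt_le_trans h1 _; rewrite -natr1 lerD2r.
  move=> e1 e2.
  have := H _ _ _ _ e1; have := H _ _ _ _ (esym e1).
  have := H _ _ _ _ e2; have := H _ _ _ _ (esym e2).
  have z1 : 0 <= 2 * ((pos x).1 - p.1 + r) by lra.
  have z2 : 0 <= 2 * ((pos x).2 - p.2 + r) by lra.
  have z3 : 0 <= 2 * ((pos y).1 - p.1 + r) by lra.
  have z4 : 0 <= 2 * ((pos y).2 - p.2 + r) by lra.
  move=> /(_ z4 z2) h1 /(_ z2 z4) h2 /(_ z3 z1) h3 /(_ z1 z3) h4.
  by apply/and4P; split; lra.
rewrite -(size_map f) -(card_uniqP _); last by rewrite map_inj_in_uniq.
by apply: leq_trans (max_card _) _; rewrite card_prod !card_ord /packing expnS expn1.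
Qed.

End Packing.

Section Distance.
Variable R : realType.
Implicit Types p q x y : R * R.

Definition sqd p q : R := (p.1 - q.1) ^+ 2 + (p.2 - q.2) ^+ 2.

Lemma sqd_ge0 p q : 0 <= sqd p q.
Proof. by rewrite addr_ge0 // sqr_ge0. Qed.

Lemma edist_lt p q r : 0 < r -> (Defs.edist p q < r) = (sqd p q < r ^+ 2).
Proof.
move=> r0; rewrite -{1}(gtr0_norm r0) -sqrtr_sqr /Defs.edist -/(sqd p q).
by rewrite ltr_sqrt // exprn_gt0.
Qed.

Lemma edist_eq1 p q : (Defs.edist p q == 1) = (sqd p q == 1).
Proof.
rewrite -{1}sqrtr1 /Defs.edist -/(sqd p q) eqr_sqrt //; exact: sqd_ge0.
Qed.

Lemma sqdC p q : sqd p q = sqd q p.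
Proof. rewrite /sqd; ring. Qed.

Lemma open_disk_open p (r : R) : 0 < r -> open (open_disk p r).
Proof.
move=> r0.
have -> : open_disk p r = (fun q => sqd q p) @^-1` [set t | t < r ^+ 2].
  by rewrite eqEsubset; split => q; rewrite /open_disk /= edist_lt.
apply: open_comp; last exact: open_lt.
move=> q _; rewrite /sqd.
have c1 : (fun q : R * R => q.1 - p.1) @ q --> q.1 - p.1.
  by apply: cvgB; [exact: cvg_fst|exact: cvg_cst].
have c2 : (fun q : R * R => q.2 - p.2) @ q --> q.2 - p.2.
  by apply: cvgB; [exact: cvg_snd|exact: cvg_cst].
by apply: cvgD; apply: cvgM.
Qed.

End Distance.

Section Geometry.
Variables (R : realType) (G : penny_graph R).
Local Notation c := (Defs.center G).

(** If two centers were closer, their midpoint would lie in both disks. *)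
Lemma center_sep i j : i != j -> 1 <= sqd (c i) (c j).
Proof.
move=> ij; rewrite leNgt; apply/negP => h.
apply: (elimN eqP ij); apply: (@disks_disjoint _ G i j I I).
pose m := (((c i).1 + (c j).1) / 2, ((c i).2 + (c j).2) / 2).
have h2 : (0 : R) < 2^-1 by rewrite invr_gt0.
exists m; rewrite /open_disk; split; rewrite /= edist_lt //.
  have -> : sqd m (c i) = sqd (c i) (c j) * 2^-1 ^+ 2.
    by rewrite /sqd /m /=; field.
  by rewrite gtr_pMl // exprn_gt0.
have -> : sqd m (c j) = sqd (c i) (c j) * 2^-1 ^+ 2.
  by rewrite /sqd /m /=; field.
by rewrite gtr_pMl // exprn_gt0.
Qed.

Lemma center_box_sep i j : i != j -> ~~ box (c i) 2^-1 (c j).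
Proof.
move=> /center_sep h; apply/negP => /and4P[h1 h2 h3 h4].
suff : sqd (c i) (c j) < 1 by rewrite ltNge h.
by rewrite /sqd; nra.
Qed.

Lemma adj_sym i j : adj G i j = adj G j i.
Proof. by rewrite /adj !edist_eq1 sqdC eq_sym. Qed.

Lemma adj_sqd i j : adj G i j -> sqd (c i) (c j) = 1.
Proof. by move=> /andP[_]; rewrite edist_eq1 => /eqP. Qed.

Lemma sqd_box (p q : R * R) : sqd p q <= 1 -> box p 1 q.
Proof.
rewrite /sqd => h; have h1 := sqr_ge0 (p.1 - q.1); have h2 := sqr_ge0 (p.2 - q.2).
have H (x : R) : x ^+ 2 <= 1 -> -1 <= x <= 1.
  by move=> hx; apply/andP; split; nra.
have /andP[a1 a2] : -1 <= p.1 - q.1 <= 1 by apply: H; lra.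
have /andP[b1 b2] : -1 <= p.2 - q.2 <= 1 by apply: H; lra.
by apply/and4P; split; lra.
Qed.

Lemma adj_box i j : adj G i j -> box (c i) 1 (c j).
Proof. by move=> /adj_sqd h; apply: sqd_box; rewrite h. Qed.

Lemma vertex_box_finite p r : finite_set [set i | box p r (c i)].
Proof.
apply: contrapT => inf.
have [B sB] := infinite_set_fset (packing r).+1 inf.
rewrite leqNgt ltnS => /negP; apply.
apply: (packing_bound center_box_sep (p := p)); first exact: finmap.fset_uniq.
by move=> x xB; apply: sB.
Qed.

Definition vbox p r : seq nat :=
  finmap.enum_fset (fset_set [set i | box p r (c i)]).

Lemma mem_vbox p r i : (i \in vbox p r) = box p r (c i).
Proof.
rewrite /vbox in_fset_set ?in_setE; last exact: vertex_box_finite.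
by apply/idP/idP; rewrite in_setE.
Qed.

Lemma vbox_uniq p r : uniq (vbox p r).
Proof. exact: finmap.fset_uniq. Qed.

Lemma size_vbox p r : (size (vbox p r) <= packing r)%N.
Proof.
apply: (packing_bound center_box_sep (p := p)); first exact: vbox_uniq.
by move=> x; rewrite mem_vbox.
Qed.

(* Vertices are treated as degenerate edges. *)
Definition link i j := (i == j) || adj G i j.

Lemma link_sym i j : link i j = link j i.
Proof. by rewrite /link eq_sym adj_sym. Qed.

Lemma link_sqd i j : link i j -> sqd (c i) (c j) <= 1.
Proof.
case/orP => [/eqP->|/adj_sqd -> //].
by rewrite /sqd !subrr expr0n /= addr0.
Qed.

Lemma embedded_imageP p :
  embedded_image G p <-> exists i j, link i j /\ segment (c i) (c j) p.
Proof.
split.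
  case=> [[i ->]|[i [j [a s]]]].
    by exists i, i; split; [rewrite /link eqxx|exact: segment_left].
  by exists i, j; split => //; rewrite /link a orbT.
move=> [i [j [/orP[/eqP<-|a] s]]]; last by right; exists i, j.
left; exists i; case: s => t _ <-; rewrite /line_path -!mulrDl subrK !mul1r.
by rewrite -surjective_pairing.
Qed.

Lemma segment_sym (p q : R * R) : segment p q = segment q p.
Proof.
have H (a b : R * R) : segment a b `<=` segment b a.
  move=> x [t /=]; rewrite in_itv /= => /andP[t0 t1] <-.
  exists (1 - t); first by rewrite /= in_itv /=; apply/andP; split; lra.
  by rewrite /line_path /=; congr (_, _); ring.
by rewrite eqEsubset; split; exact: H.
Qed.

(** Stewart's identity: the squared distance is a convex combination of two numbers at least 1,
    minus [t * (1 - t)] times a number at most 1, a loss of at most 1/4. *)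
Lemma vertex_edge_sep i k l q : link k l -> i != k -> i != l ->
  segment (c k) (c l) q -> 3 / 4 <= sqd (c i) q.
Proof.
move=> /link_sqd kl /center_sep ik /center_sep il [t /=]; rewrite in_itv /=.
move=> /andP[t0 t1] <-.
have -> : sqd (c i) (line_path (c k).1 (c l).1 t, line_path (c k).2 (c l).2 t)
  = (1 - t) * sqd (c i) (c k) + t * sqd (c i) (c l)
    - t * (1 - t) * sqd (c k) (c l).
  by rewrite /sqd /line_path /=; ring.
move: (sqd (c k) _) (sqd (c i) _) (sqd (c i) _) kl ik il => A B C hA hB hC.
have h1 : 0 <= t * (1 - t) by rewrite mulr_ge0 // subr_ge0.
have h2 : 0 <= t * (C - 1) by rewrite mulr_ge0 // subr_ge0.
have h3 : 0 <= (1 - t) * (B - 1) by rewrite mulr_ge0 // subr_ge0.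
have h4 : 0 <= t * (1 - t) * (1 - A) by rewrite mulr_ge0 // subr_ge0.
have h5 : 0 <= (t - 1 / 2) ^+ 2 by exact: sqr_ge0.
nra.
Qed.

(** Stewart's identity in both parameters: an average of four numbers at least 1, minus two terms of
    at most 1/4 each. *)
Lemma edge_edge_sep i j k l p q : link i j -> link k l ->
  i != k -> i != l -> j != k -> j != l ->
  segment (c i) (c j) p -> segment (c k) (c l) q -> 1 / 2 <= sqd p q.
Proof.
move=> /link_sqd ij /link_sqd kl /center_sep ik /center_sep il.
move=> /center_sep jk /center_sep jl [s /=]; rewrite in_itv /=.
move=> /andP[s0 s1] <- [t /=]; rewrite in_itv /= => /andP[t0 t1] <-.
have -> : sqd (line_path (c i).1 (c j).1 s, line_path (c i).2 (c j).2 s)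
              (line_path (c k).1 (c l).1 t, line_path (c k).2 (c l).2 t)
  = (1 - s) * (1 - t) * sqd (c i) (c k) + (1 - s) * t * sqd (c i) (c l)
    + s * (1 - t) * sqd (c j) (c k) + s * t * sqd (c j) (c l)
    - s * (1 - s) * sqd (c i) (c j) - t * (1 - t) * sqd (c k) (c l).
  by rewrite /sqd /line_path /=; ring.
have s' : 0 <= 1 - s by rewrite subr_ge0.
have t' : 0 <= 1 - t by rewrite subr_ge0.
have := mulr_ge0 (mulr_ge0 s' t') (_ : 0 <= sqd (c i) (c k) - 1).
have := mulr_ge0 (mulr_ge0 s' t0) (_ : 0 <= sqd (c i) (c l) - 1).
have := mulr_ge0 (mulr_ge0 s0 t') (_ : 0 <= sqd (c j) (c k) - 1).
have := mulr_ge0 (mulr_ge0 s0 t0) (_ : 0 <= sqd (c j) (c l) - 1).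
have := mulr_ge0 (mulr_ge0 s0 s') (_ : 0 <= 1 - sqd (c i) (c j)).
have := mulr_ge0 (mulr_ge0 t0 t') (_ : 0 <= 1 - sqd (c k) (c l)).
rewrite !subr_ge0 => /(_ kl) h1 /(_ ij) h2 /(_ jl) h3 /(_ jk) h4 /(_ il) h5.
move=> /(_ ik) h6.
have h7 : 0 <= (t - 1 / 2) ^+ 2 by exact: sqr_ge0.
have h8 : 0 <= (s - 1 / 2) ^+ 2 by exact: sqr_ge0.
nra.
Qed.

Lemma link_segment_box i j p : link i j -> segment (c i) (c j) p ->
  box p 1 (c i) && box p 1 (c j).
Proof.
move=> l s; have /sqd_box /and4P[h1 h2 h3 h4] := link_sqd l.
move: s => [t /=]; rewrite in_itv /= => /andP[t0 t1] <-.
rewrite /box /line_path /=.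
by apply/andP; split; apply/and4P; split; nra.
Qed.

(** Local finiteness: a link that meets the unit box about [x] has its ends among the finitely many
    vertices in the box of radius 2, and each segment is closed. *)
Lemma closed_embedded_image : closed (embedded_image G).
Proof.
move=> x cx; apply: contrapT => nx.
have key (l : seq (nat * nat)) :
    (forall ij, ij \in l -> link ij.1 ij.2) ->
    exists2 e : R, 0 < e & forall y, box x e y ->
      forall ij, ij \in l -> ~ segment (c ij.1) (c ij.2) y.
  elim: l => [|[i j] l IH] hl; first by exists 1.
  have [|e e0 He] := IH; first by move=> ij h; apply: hl; rewrite inE h orbT.
  have : nbhs x (~` segment (c i) (c j)).
    apply: open_nbhs_nbhs; split; first exact/closed_openC/closed_segment.
    move=> s; apply: nx; apply/embedded_imageP; exists i, j; split => //.
    by apply: (hl (i, j)); rewrite inE eqxx.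
  move=> /nbhs_boxP[e' e0' He']; exists (Num.min e e').
    by rewrite lt_min e0.
  have sub e1 e2 y : e1 <= e2 -> box x e1 y -> box x e2 y.
    by move=> h; rewrite !box_norm => /le_trans; apply.
  move=> y hy ij; rewrite inE => /orP[/eqP->|h].
    by apply: He'; apply: sub hy; rewrite ge_min lexx orbT.
  by apply: He h; apply: sub hy; rewrite ge_min lexx.
have [|e e0 He] := key [seq ij <- allpairs pair (vbox x 2) (vbox x 2) | link ij.1 ij.2].
  by move=> ij; rewrite mem_filter => /andP[].
have : nbhs x [set y | box x e y /\ box x 1 y].
  apply/nbhs_boxP; exists (Num.min e 1); first by rewrite lt_min e0 ltr01.
  by move=> y; rewrite /= !box_norm le_min => /andP[? ?]; split.
move=> /cx [y [/embedded_imageP [i [j [l s]]] [h1 h2]]].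
apply: (He y h1 (i, j)) => //.
rewrite mem_filter l /=; apply/allpairsP; exists (i, j) => /=.
rewrite !mem_vbox; have /andP[] := link_segment_box l s.
move=> /and4P[a1 a2 a3 a4] /and4P[b1 b2 b3 b4].
by case/and4P: h2 => *; split => //; apply/and4P; split; lra.
Qed.

End Geometry.

Section Geometry.
Variables (R : realType) (G : penny_graph R).
Local Notation c := (Defs.center G).
Local Notation link := (link G).

Lemma corner_of_point b v y :
  connected_component (~` embedded_image G) b y -> open_disk (c v) 2^-1 y ->
  exists S, corners G (connected_component (~` embedded_image G) b) (v, S) /\ S y.
Proof.
move=> by_ dy; have ny := connected_component_sub by_.
have Uy : (open_disk (c v) 2^-1 `\` embedded_image G) y by [].
exists (connected_component (open_disk (c v) 2^-1 `\` embedded_image G) y).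
split; last exact: connected_component_refl.
split; first by exists y.
rewrite /= (same_connected_component by_).
apply: connected_component_max; last exact: component_connected.
  exact: connected_component_refl.
by move=> z /connected_component_sub [].
Qed.

(* A boundary point that lies in none of the open disks is the midpoint of an
   edge; a nearby point of the face is then moved parallel to this edge. *)
Lemma boundary_corner b a : embedded_image G a ->
  closure (connected_component (~` embedded_image G) b) a ->
  exists v S, [/\ corners G (connected_component (~` embedded_image G) b) (v, S),
    S !=set0 & box (c v) 1 a].
Proof.
move=> /embedded_imageP [i [j [l s]]] ca.
suff [v [y [hy dy hv]]] : exists v y,
   [/\ connected_component (~` embedded_image G) b y, open_disk (c v) 2^-1 y
     & box (c v) 1 a].
  have [S [hS Sy]] := corner_of_point hy dy.
  by exists v, S; split => //; exists y.
have h2 : (0 : R) < 2^-1 by rewrite invr_gt0.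
have easy k m t : link k m -> 0 <= t < 1 / 2 ->
  a = (line_path (c k).1 (c m).1 t, line_path (c k).2 (c m).2 t) ->
  exists v y, [/\ connected_component (~` embedded_image G) b y,
     open_disk (c v) 2^-1 y & box (c v) 1 a].
  move=> km /andP[t0 t1] ea; exists k.
  have da : sqd a (c k) < 2^-1 ^+ 2.
    have -> : sqd a (c k) = t ^+ 2 * sqd (c k) (c m).
      by rewrite ea /sqd /line_path /=; ring.
    have := link_sqd km; have := sqd_ge0 (c k) (c m).
    by move: (sqd _ _) => A A0 A1; nra.
  have : nbhs a (open_disk (c k) 2^-1).
    apply: open_nbhs_nbhs; split; first exact: open_disk_open.
    by rewrite /open_disk /= edist_lt.
  move=> /ca [y [hy dy]]; exists y; split => //.
  by apply: sqd_box; rewrite sqdC; move: da; move: (sqd _ _) => A; lra.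
move: (s) => [t /=]; rewrite in_itv /= => /andP[t0 t1] /esym ea.
have [tlt|tge] := ltP t (1 / 2).
  by apply: (easy i j t) => //; rewrite t0.
have [tgt|tle] := ltP (1 / 2) t.
  apply: (easy j i (1 - t)); first by rewrite link_sym.
    by apply/andP; split; lra.
  by rewrite ea /line_path /=; congr (_, _); ring.
have {t0 t1 tge tle} th : t = 1 / 2 by lra.
have [ij|ij] := eqVneq i j.
  apply: (easy i i 0); rewrite /link ?eqxx //; first by apply/andP; split; lra.
  by rewrite ea ij /line_path /=; congr (_, _); ring.
have : nbhs a [set y | box a (1 / 100) y].
  by apply/nbhs_boxP; exists (1 / 100) => //; rewrite divr_gt0.
move=> /ca [y [hy /and4P[y1 y2 y3 y4]]].
(* [d] runs from the midpoint [a] to [c i] and has length 1/2; moving [y] by a quarter of [d] brings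
   it to about 3/8 from [c i]. *)
pose d := ((c i).1 - a.1, (c i).2 - a.2).
pose y' := (y.1 + 1 / 4 * d.1, y.2 + 1 / 4 * d.2).
have lij := l; move: l; rewrite /link (negbTE ij) /= => /adj_sqd sij.
have d4 : d.1 ^+ 2 + d.2 ^+ 2 = 1 / 4.
  have -> : d.1 ^+ 2 + d.2 ^+ 2 = sqd (c i) (c j) / 4.
    by rewrite /d ea th /sqd /line_path /=; field.
  by rewrite sij.
have ci : c i = (a.1 + d.1, a.2 + d.2).
  by rewrite [LHS]surjective_pairing /d /=; congr (_, _); ring.
have cj : c j = (a.1 - d.1, a.2 - d.2).
  by rewrite [LHS]surjective_pairing /d ea th /line_path /=; congr (_, _); field.
pose w := (y.1 - a.1, y.2 - a.2).
have ey : y = (a.1 + w.1, a.2 + w.2).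
  by rewrite [LHS]surjective_pairing /w /=; congr (_, _); ring.
have w2 : w.1 ^+ 2 + w.2 ^+ 2 <= 1 / 5000 by rewrite /w /=; nra.
clear y1 y2 y3 y4.
have wd : - (1 / 100) <= w.1 * d.1 + w.2 * d.2 <= 1 / 100.
  have := sqr_ge0 (50 * w.1 + d.1); have := sqr_ge0 (50 * w.2 + d.2).
  have := sqr_ge0 (50 * w.1 - d.1); have := sqr_ge0 (50 * w.2 - d.2).
  move=> e1 e2 e3 e4; apply/andP; split; nra.
case/andP: wd => wd1 wd2.
exists i, y'; split; last 2 first.
- rewrite /open_disk /= edist_lt //.
  have -> : sqd y' (c i) = (w.1 ^+ 2 + w.2 ^+ 2)
      - 3 / 2 * (w.1 * d.1 + w.2 * d.2) + 9 / 16 * (d.1 ^+ 2 + d.2 ^+ 2).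
    by rewrite /y' ey ci /sqd /=; field.
  by rewrite d4; lra.
- apply: sqd_box.
  have -> : sqd (c i) a = d.1 ^+ 2 + d.2 ^+ 2 by rewrite ci /sqd /=; ring.
  by rewrite d4; lra.
have niy := connected_component_sub hy.
apply: connected_component_trans hy _; apply: segment_component.
move=> z [u /=]; rewrite in_itv /= => /andP[u0 u1] ez.
move=> /embedded_imageP [k [m [lkm skm]]].
have ez' : z = (a.1 + w.1 + u / 4 * d.1, a.2 + w.2 + u / 4 * d.2).
  by rewrite -ez /y' ey /line_path /=; congr (_, _); field.
(* By [vertex_edge_sep], a link through a point this close to [c i] and to [c j] has both of them as
   ends. *)
have zi : sqd (c i) z < 3 / 4.
  have -> : sqd (c i) z = (w.1 ^+ 2 + w.2 ^+ 2)
      - 2 * (1 - u / 4) * (w.1 * d.1 + w.2 * d.2)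
      + (1 - u / 4) ^+ 2 * (d.1 ^+ 2 + d.2 ^+ 2).
    by rewrite ez' ci /sqd /=; ring.
  by rewrite d4; nra.
have zj : sqd (c j) z < 3 / 4.
  have -> : sqd (c j) z = (w.1 ^+ 2 + w.2 ^+ 2)
      + 2 * (1 + u / 4) * (w.1 * d.1 + w.2 * d.2)
      + (1 + u / 4) ^+ 2 * (d.1 ^+ 2 + d.2 ^+ 2).
    by rewrite ez' cj /sqd /=; ring.
  by rewrite d4; nra.
have hi : (i == k) || (i == m).
  apply: contraT; rewrite negb_or => /andP[ik im].
  by have := vertex_edge_sep lkm ik im skm; rewrite leNgt zi.
have hj : (j == k) || (j == m).
  apply: contraT; rewrite negb_or => /andP[ik im].
  by have := vertex_edge_sep lkm ik im skm; rewrite leNgt zj.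
have {}skm : segment (c i) (c j) z.
  case/orP: hi => /eqP ei; case/orP: hj => /eqP ej.
  - by rewrite ei ej eqxx in ij.
  - by rewrite ei ej.
  - by rewrite ei ej segment_sym.
  - by rewrite ei ej eqxx in ij.
(* With [z] on the edge, [w] is a multiple of [d], so [y] would lie on this edge too. *)
apply: niy; apply/embedded_imageP; exists i, j; split => //.
move: skm => [v _ ezv].
have e1 : w.1 = (1 - 2 * v - u / 4) * d.1.
  by move: ez'; rewrite -ezv ci cj /line_path /= => -[]; lra.
have e2 : w.2 = (1 - 2 * v - u / 4) * d.2.
  by move: ez'; rewrite -ezv ci cj /line_path /= => -[]; lra.
move: (1 - 2 * v - u / 4) e1 e2 => g e1 e2.
have g2 : g ^+ 2 <= 1.
  have : w.1 ^+ 2 + w.2 ^+ 2 = g ^+ 2 * (d.1 ^+ 2 + d.2 ^+ 2).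
    by rewrite e1 e2; ring.
  by rewrite d4; lra.
exists ((1 - g) / 2).
  by rewrite /= in_itv /=; apply/andP; split; nra.
by rewrite ey ci cj e1 e2 /line_path /=; congr (_, _); field.
Qed.

End Geometry.

(** * Faces are bounded *)

Section Faces.
Variables (R : realType) (G : penny_graph R).
Local Notation c := (Defs.center G).
Local Notation link := (link G).
Local Notation face b := (connected_component (~` embedded_image G) b).

Lemma path_meets_sphere (p : R * R) (r : R) v s : path (adj G) v s ->
  `|c v - p| <= r -> r <= `|c (last v s) - p| ->
  embedded_image G `&` sphere p r !=set0.
Proof.
elim: s v => [|w s IH] v /=.
  move=> _ h1 h2; exists (c v); split; first by left; exists v.
  by apply/eqP; rewrite /sphere eq_le h1.
move=> /andP[vw ps] h1 h2; have [wr|rw] := leP `|c w - p| r.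
  exact: IH wr h2.
have [x [sx hx]] := connected_meets_sphere (@segment_connected_plane R (c v) (c w))
  (segment_left _ _) (segment_right _ _) h1 (ltW rw).
by exists x; split => //; right; exists v, w.
Qed.

Lemma far_vertex (p : R * R) (r : R) : exists v, r < `|c v - p|.
Proof.
apply: contrapT => h.
have hs : (size (iota 0 (packing r).+1) <= packing r)%N.
  apply: (packing_bound (@center_box_sep R G) (p := p)); first exact: iota_uniq.
  move=> v _; rewrite box_norm leNgt; apply/negP => hv.
  by apply: h; exists v.
by move: hs; rewrite size_iota ltnn.
Qed.

Lemma image_meets_sphere v (r : R) : graph_connected G -> 0 <= r ->
  embedded_image G `&` sphere (c v) r !=set0.
Proof.
move=> cG r0; have [w hw] := far_vertex (c v) r.
have [n [s [ps ls _]]] := cG v w.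
by apply: path_meets_sphere ps _ _; rewrite ?ls ?(ltW hw) // subrr normr0.
Qed.

(** The last of [truncn D + 1] candidate radii, one more than the vertices that can carry corners of
    a face. *)
Definition face_radius (D : R) : R := 3 * (Num.truncn D).+1%:R.

(* The radius is chosen among 3, 6, 9, ... so that the sphere stays at distance
   more than 1 from every vertex carrying a corner of the face. *)
Lemma face_bounded (D : R) : graph_connected G ->
  (forall sigma, faces G sigma -> (facial_degree G sigma <= D%:E)%E) ->
  forall b, ~ embedded_image G b ->
  exists v, forall x, face b x -> box (c v) (face_radius D) x.
Proof.
move=> cG hD b nb.
have fb : faces G (face b) by exists b.
have bb : face b b by apply: connected_component_refl.
have img0 : embedded_image G (c 0%N) by left; exists 0%N.
(* A boundary point of the face on the way to vertex 0 yields a corner, whose vertex [v] becomes the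
   centre of the box. *)
have [a [_ Ia ca]] : exists a, [/\ segment b (c 0%N) a, embedded_image G a
    & closure (face b) a].
  apply: component_first_hit; first exact: closed_embedded_image.
  - exact: segment_connected_plane.
  - by exists b; split => //; exact: segment_left.
  - by exists (c 0%N); split => //; exact: segment_right.
have [v [S [[[z dz Sz] Ssub] [y Sy] _]]] := boundary_corner Ia ca; exists v.
rewrite /= in Sz Ssub dz.
have yv : `|y - c v| < 1.
  move: Sy; rewrite -Sz => /connected_component_sub [/= + _].
  rewrite /open_disk /= edist_lt ?invr_gt0 // => hy.
  apply: (le_lt_trans (y := 2^-1)); last by rewrite invf_lt1 ?ltr1n.
  rewrite -box_norm; apply/and4P.
  have := sqr_ge0 (y.1 - (c v).1); have := sqr_ge0 (y.2 - (c v).2).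
  have H (x : R) : x ^+ 2 < 2^-1 ^+ 2 -> - 2^-1 <= x <= 2^-1.
    by move=> hx; apply/andP; split; nra.
  move: hy; rewrite /sqd => hy s1 s2.
  have /andP[a1 a2] : - 2^-1 <= y.1 - (c v).1 <= 2^-1 by apply: H; lra.
  have /andP[b1 b2] : - 2^-1 <= y.2 - (c v).2 <= 2^-1 by apply: H; lra.
  by split; lra.
have := hD _ fb; rewrite /facial_degree /counting.
case: asboolP => // fin; rewrite lee_fin => hcard.
set N := Num.truncn D.
pose vs := [seq vS.1 | vS <- finmap.enum_fset (fset_set (corners G (face b)))].
have svs : (size vs <= N)%N.
  by rewrite size_map /N -[X in (X <= _)%N](@natrK R) le_truncn.
have mvs w T : corners G (face b) (w, T) -> w \in vs.
  move=> h; apply/mapP; exists (w, T) => //.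
  by rewrite in_fset_set // in_setE.
(* Pigeonhole: the [N + 1] intervals of radius 1 about 3, 6, 9, ... are disjoint, and at most [N]
   vertices carry corners. *)
have [j hj] : exists j : 'I_N.+1, forall w, w \in vs ->
    ~ (3 * j.+1%:R - 1 <= `|c w - c v| <= 3 * j.+1%:R + 1).
  apply: contrapT => hno.
  have /choice[f hf] : forall j : 'I_N.+1, exists w, w \in vs /\
      (3 * j.+1%:R - 1 <= `|c w - c v| <= 3 * j.+1%:R + 1).
    move=> j; apply: contrapT => hj; apply: hno; exists j => w wvs hw.
    by apply: hj; exists w.
  have finj : injective f.
    move=> i j fij; have [_ /andP[i1 i2]] := hf i; have [_ /andP[j1 j2]] := hf j.
    rewrite fij in i1 i2; apply/val_inj/eqP => /=; rewrite eqn_leq.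
    have h1 : (i.+1%:R : R) < j.+2%:R by rewrite -(natr1 j.+1); lra.
    have h2 : (j.+1%:R : R) < i.+2%:R by rewrite -(natr1 i.+1); lra.
    by rewrite !ltr_nat !ltnS in h1 h2; rewrite h1 h2.
  have : (size (codom f) <= size vs)%N.
    apply: uniq_leq_size; first by apply/injectiveP.
    by move=> w /codomP[i ->]; have [] := hf i.
  by rewrite size_codom card_ord leqNgt ltnS svs.
pose r : R := 3 * j.+1%:R.
have r3 : 3 <= r by rewrite /r ler_peMr // ler1n.
have rle : r <= face_radius D.
  by rewrite /r /face_radius ler_pM2l // ler_nat ltnS leq_ord.
(* The sphere is connected and meets the graph. If it met the face, it would contain a boundary
   point of the face, within 1 of a vertex carrying a corner, against the choice of [j]. *)
have dis : ~ (sphere (c v) r `&` face b !=set0).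
  move=> hs.
  have [||a' [sa' Ia' ca']] := component_first_hit (C := sphere (c v) r)
    (b := b) (@closed_embedded_image R G) _ hs _.
  - by apply: sphere_connected; lra.
  - by have [|q [q1 q2]] := @image_meets_sphere v r cG; [lra|exists q].
  have [w [T [hT _ bw]]] := boundary_corner Ia' ca'.
  apply: (hj w (mvs _ _ hT)); rewrite -/r.
  move: bw sa'; rewrite box_norm /sphere /= => bw sa'.
  have : `|c w - c v| <= `|a' - c w| + `|a' - c v|.
    by rewrite (distrC a' (c w)) (le_trans _ (ler_normD _ _)) // addrA subrK.
  have : `|a' - c v| <= `|a' - c w| + `|c w - c v|.
    by rewrite (le_trans _ (ler_normD _ _)) // addrA subrK.
  by rewrite sa'; move=> h1 h2; apply/andP; split; lra.
move=> x bx; rewrite box_norm; apply: le_trans rle.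
rewrite leNgt; apply/negP => hx; apply: dis.
have [||q [q1 q2]] := connected_meets_sphere (@component_connected _ (~` embedded_image G) b)
  (Ssub _ Sy) bx (p := c v) (r := r); last by exists q.
- by apply: ltW; apply: lt_le_trans yv _; lra.
- exact: ltW.
Qed.

Lemma near_vertex (D : R) : graph_connected G ->
  (forall sigma, faces G sigma -> (facial_degree G sigma <= D%:E)%E) ->
  forall p, exists v, box p (face_radius D) (c v).
Proof.
move=> cG hD p; have [Ip|nIp] := pselect (embedded_image G p).
  have /embedded_imageP [i [j [l s]]] := Ip; exists i.
  have /andP[+ _] := link_segment_box l s; rewrite !box_norm => /le_trans; apply.
  by rewrite /face_radius -[X in X <= _]mulr1 ler_pM ?ler1n // ler1n.
have [v hv] := face_bounded cG hD nIp; exists v.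
rewrite box_norm distrC -box_norm; apply: hv.
exact: connected_component_refl.
Qed.

End Faces.

(** * Local connectivity *)

(** Poincare lemma mod 2: the primitive sums the cochain along row 0 and then up column [i]. *)
Lemma closed_cochain_exact (Gh Gv : nat -> nat -> bool) :
  (forall i j, Gh i j (+) Gv i.+1 j = Gv i j (+) Gh i j.+1) ->
  exists g : nat -> nat -> bool,
    (forall i j, g i.+1 j = g i j (+) Gh i j) /\
    (forall i j, g i j.+1 = g i j (+) Gv i j).
Proof.
move=> cl; exists (fun i j =>
  (\big[addb/false]_(a < i) Gh a 0%N) (+) (\big[addb/false]_(b < j) Gv i b)).
have v i j : (\big[addb/false]_(b < j.+1) Gv i b) =
    (\big[addb/false]_(b < j) Gv i b) (+) Gv i j by rewrite big_ord_recr.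
split=> i j; last by rewrite v addbA.
elim: j => [|j IH]; first by rewrite !big_ord0 !addbF big_ord_recr.
by rewrite !v !addbA IH -!addbA; congr (_ (+) (_ (+) _)); rewrite cl.
Qed.

(** A function jumps an even number of times around a square. The mask [u] preserves this, since by
    hypothesis it holds at all four corners as soon as it keeps one jump. *)
Lemma square_parity (u1 u2 u3 u4 f1 f2 f3 f4 : bool) :
  ([|| (f1 (+) f2) && u1, (f2 (+) f4) && u2, (f1 (+) f3) && u1 |
       (f3 (+) f4) && u3] -> [&& u1, u2, u3 & u4]) ->
  (f1 (+) f2) && u1 (+) (f2 (+) f4) && u2 =
  (f1 (+) f3) && u1 (+) (f3 (+) f4) && u3.
Proof.
by case: u1; case: u2; case: u3; case: u4; case: f1; case: f2; case: f3;
  case: f4 => // /(_ isT).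
Qed.

Lemma locally_constant_segment (R : realType) (F : R * R -> bool) (e : R)
    (x y : R * R) : 0 < e ->
  (forall z w, segment x y z -> segment x y w -> box z e w -> F z = F w) ->
  F x = F y.
Proof.
move=> e0 H; pose n := (Num.truncn (`|y - x| / e)).+1.
have n0 : 0 < n%:R :> R by rewrite ltr0n.
have hn : `|y - x| <= n%:R * e.
  by rewrite -ler_pdivrMr // ltW // truncnS_gt.
pose z k : R * R := (line_path x.1 y.1 (k%:R / n%:R), line_path x.2 y.2 (k%:R / n%:R)).
have sz k : (k <= n)%N -> segment x y (z k).
  move=> kn; exists (k%:R / n%:R) => //=; rewrite in_itv /=.
  by rewrite divr_ge0 ?ler0n //= ler_pdivrMr // mul1r ler_nat.
have Fz k : (k <= n)%N -> F (z k) = F x.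
  elim: k => [_|k IH kn].
    by rewrite /z /line_path mulr0n !mul0r !subr0 !mul1r !addr0 -surjective_pairing.
  rewrite -(IH (ltnW kn)); apply/esym/H; [exact/sz/ltnW|exact: sz|].
  move: hn; rewrite -box_norm => /and4P[h1 h2 h3 h4].
  have step (a b : R) : a - n%:R * e <= b -> b <= a + n%:R * e ->
      line_path a b (k%:R / n%:R) - e <= line_path a b (k.+1%:R / n%:R)
      /\ line_path a b (k.+1%:R / n%:R) <= line_path a b (k%:R / n%:R) + e.
    move=> ha hb.
    have -> : line_path a b (k.+1%:R / n%:R) =
        line_path a b (k%:R / n%:R) + (b - a) / n%:R.
      by rewrite /line_path -natr1; field; rewrite gt_eqF.
    have : - e <= (b - a) / n%:R by rewrite ler_pdivlMr //; lra.
    have : (b - a) / n%:R <= e by rewrite ler_pdivrMr //; lra.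
    by split; lra.
  have [s1 s2] := step _ _ h1 h2; have [s3 s4] := step _ _ h3 h4.
  by apply/and4P; split.
rewrite -(Fz n (leqnn n)); congr F.
rewrite /z divff ?gt_eqF // /line_path !subrr !mul0r !add0r !mul1r.
by rewrite -surjective_pairing.
Qed.

(** * Sampling on a lattice of mesh 1/32 *)

Section Lattice.
Variables (R : realType) (o : R * R).

Definition lattice_pt (i j : nat) : R * R := (o.1 + i%:R / 32, o.2 + j%:R / 32).
Definition lattice_row (z : R * R) : nat := Num.truncn (32 * (z.1 - o.1)).
Definition lattice_col (z : R * R) : nat := Num.truncn (32 * (z.2 - o.2)).

Lemma lattice_near z : o.1 <= z.1 -> o.2 <= z.2 ->
  box z (1 / 32) (lattice_pt (lattice_row z) (lattice_col z)).
Proof.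
move=> z1 z2.
have tr (x : R) : 0 <= x ->
    (Num.truncn x)%:R <= x /\ x < (Num.truncn x)%:R + 1.
  by move=> /truncn_itv /andP[h1]; rewrite -natr1.
have [|a1 a2] := tr (32 * (z.1 - o.1)); first by rewrite mulr_ge0 // subr_ge0.
have [|a3 a4] := tr (32 * (z.2 - o.2)); first by rewrite mulr_ge0 // subr_ge0.
by apply/and4P; rewrite /lattice_pt /lattice_row /lattice_col /=; split; lra.
Qed.

(** Points within one mesh of each other round down to indices that differ by at most one, so at
    most one horizontal and one vertical step, both near [z], link their lattice points. *)
Lemma lattice_constant (h : nat -> nat -> bool) (z w : R * R) :
  o.1 <= z.1 -> o.2 <= z.2 -> o.1 <= w.1 -> o.2 <= w.2 -> box z (1 / 32) w ->
  (forall i j, box z (3 / 32) (lattice_pt i j) ->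
     box z (3 / 32) (lattice_pt i.+1 j) -> h i j = h i.+1 j) ->
  (forall i j, box z (3 / 32) (lattice_pt i j) ->
     box z (3 / 32) (lattice_pt i j.+1) -> h i j = h i j.+1) ->
  h (lattice_row z) (lattice_col z) = h (lattice_row w) (lattice_col w).
Proof.
move=> z1 z2 w1 w2 /and4P[b1 b2 b3 b4] Hh Hv.
have tr (x : R) : 0 <= x ->
    (Num.truncn x)%:R <= x /\ x < (Num.truncn x)%:R + 1.
  by move=> /truncn_itv /andP[h1]; rewrite -natr1.
rewrite /lattice_row /lattice_col.
have [|c1 c2] := tr (32 * (z.1 - o.1)); first by rewrite mulr_ge0 // subr_ge0.
have [|c3 c4] := tr (32 * (w.1 - o.1)); first by rewrite mulr_ge0 // subr_ge0.
have [|c5 c6] := tr (32 * (z.2 - o.2)); first by rewrite mulr_ge0 // subr_ge0.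
have [|c7 c8] := tr (32 * (w.2 - o.2)); first by rewrite mulr_ge0 // subr_ge0.
move: (Num.truncn (32 * (z.1 - o.1))) (Num.truncn (32 * (w.1 - o.1)))
  (Num.truncn (32 * (z.2 - o.2))) (Num.truncn (32 * (w.2 - o.2)))
  c1 c2 c3 c4 c5 c6 c7 c8 => i i' j j' c1 c2 c3 c4 c5 c6 c7 c8.
have near (a a' : nat) (t t' : R) : a%:R <= t -> t < a%:R + 1 ->
    a'%:R <= t' -> t' < a'%:R + 1 -> t' <= t + 1 -> t <= t' + 1 ->
    [\/ a' = a, a' = a.+1 | a = a'.+1].
  move=> h1 h2 h3 h4 h5 h6.
  have : (a'%:R : R) < a.+2%:R by rewrite -(natr1 a.+1) -natr1; lra.
  have : (a%:R : R) < a'.+2%:R by rewrite -(natr1 a'.+1) -natr1; lra.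
  rewrite !ltr_nat => n1 n2.
  have [e|e] := eqVneq a' a; first by constructor 1.
  rewrite !ltnS in n1 n2; have [e'|e'] := ltnP a a'.
    by constructor 2; apply/eqP; rewrite eqn_leq e' n2.
  by constructor 3; apply/eqP; rewrite eqn_leq n1 ltn_neqAle e.
have n1 : [\/ i' = i, i' = i.+1 | i = i'.+1].
  by apply: near c1 c2 c3 c4 _ _; lra.
have n2 : [\/ j' = j, j' = j.+1 | j = j'.+1].
  by apply: near c5 c6 c7 c8 _ _; lra.
have hb a b : a = i \/ a = i' -> b = j \/ b = j' ->
    box z (3 / 32) (lattice_pt a b).
  move=> ha hb.
  have h1 : z.1 - 3 / 32 <= o.1 + a%:R / 32 /\ o.1 + a%:R / 32 <= z.1 + 3 / 32.
    by clear -c1 c2 c3 c4 b1 b2 ha; case: ha => ->; split; lra.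
  have h2 : z.2 - 3 / 32 <= o.2 + b%:R / 32 /\ o.2 + b%:R / 32 <= z.2 + 3 / 32.
    by clear -c5 c6 c7 c8 b3 b4 hb; case: hb => ->; split; lra.
  by case: h1 => ? ?; case: h2 => ? ?; apply/and4P.
have -> : h i j = h i' j.
  case: n1 => e; first by rewrite e.
    by rewrite e; apply: Hh; [|rewrite -e]; apply: hb; auto.
  by rewrite e; apply/esym/Hh; [|rewrite -e]; apply: hb; auto.
case: n2 => e; first by rewrite e.
  by rewrite e; apply: Hv; [|rewrite -e]; apply: hb; auto.
by rewrite e; apply/esym/Hv; [|rewrite -e]; apply: hb; auto.
Qed.

End Lattice.

Section LocalConnectivity.
Variables (R : realType) (G : penny_graph R).
Local Notation c := (Defs.center G).
Local Notation link := (link G).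
Local Notation face b := (connected_component (~` embedded_image G) b).

Lemma box_le (p : R * R) (r r' : R) q : r <= r' -> box p r q -> box p r' q.
Proof. by move=> h; rewrite !box_norm => /le_trans; apply. Qed.

Lemma box_trans (p q x : R * R) (r r' : R) :
  box p r q -> box q r' x -> box p (r + r') x.
Proof.
move=> /and4P[? ? ? ?] /and4P[? ? ? ?]; apply/and4P; split; lra.
Qed.

Lemma boxC (p q : R * R) (r : R) : box p r q = box q r p.
Proof. by rewrite !box_norm distrC. Qed.

Lemma box_sqd (p q : R * R) (r : R) : box p r q -> sqd p q <= 2 * r ^+ 2.
Proof.
move=> /and4P[h1 h2 h3 h4]; rewrite /sqd.
have H (x : R) : - r <= x <= r -> x ^+ 2 <= r ^+ 2.
  by move=> /andP[? ?]; nra.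
have := H (p.1 - q.1); have := H (p.2 - q.2).
have -> : - r <= p.1 - q.1 <= r by apply/andP; split; lra.
have -> : - r <= p.2 - q.2 <= r by apply/andP; split; lra.
by move=> /(_ isT) ? /(_ isT) ?; lra.
Qed.

(* Let K be the set of vertices reachable from p inside the box, X its drawing
   and f the indicator of the points at distance at most 6/32 from X, sampled on
   a lattice of mesh 1/32.  Two edges without common endpoint are at sup distance
   at least 1/2, so a lattice edge inside the box on which f jumps is far from
   the whole graph.  Restricting the jumps of f to the faces that meet a
   neighbourhood of the segment from p to q leaves a closed cochain mod 2, whose
   primitive g jumps like f along this segment but is constant along a path of
   the graph from p to q.  So f takes the same value near p and q. *)
Lemma local_connectivity (rho l : R) (p q : nat) : 0 <= l -> 0 <= rho ->
  graph_connected G ->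
  (forall b, ~ embedded_image G b ->
     exists v, forall x, face b x -> box (c v) rho x) ->
  box (c p) l (c q) ->
  exists s, [/\ path (adj G) p s, last p s = q
    & all (fun w => box (c p) (l + 2 * rho + 5) (c w)) (p :: s)].
Proof.
(* In [M], [l + 1] reaches any point near the segment, [2 * rho] crosses its face, and the rest
   leaves room for a link beyond. *)
move=> l0 rho0 cG hrho pq; set M := l + 2 * rho + 5.
pose K w := exists s, [/\ path (adj G) p s, last p s = w
    & all (fun w => box (c p) M (c w)) (p :: s)].
apply: contrapT => nKq; have {}nKq : ~ K q by [].
have Kp : K p.
  by exists [::]; split => //=; rewrite boxxx // /M; lra.
have Kstep i j : link i j -> box (c p) M (c j) -> K i -> K j.
  move=> /orP[/eqP<- //|ij] bj [s [ps ls al]]; exists (rcons s j).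
  rewrite rcons_path last_rcons ps ls ij; split => //.
  by rewrite -rcons_cons all_rcons bj.
pose X z := exists i j, [/\ link i j, K i, K j & segment (c i) (c j) z].
pose f z := `[< exists w, X w /\ box w (6 / 32) z >].
(* A link within 4/32 of a jump with an end in [K] would lie in [X] and make [f] true on both sides.
   A link with no end in [K] is at squared distance at least 1/2 from [X], while the jump puts a
   point of [X] within 6/32 + 1/32 + 4/32 of it. *)
have door x y : box (c p) (M - 3) x -> box x (1 / 32) y -> f x (+) f y ->
    forall z, box x (4 / 32) z -> ~ embedded_image G z.
  move=> px xy fxy z xz /embedded_imageP [i [j [lij sz]]].
  have /andP[zi zj] := link_segment_box lij sz.
  have bi : box (c p) M (c i).
    by apply: box_le (box_trans (box_trans px xz) zi); lra.
  have bj : box (c p) M (c j).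
    by apply: box_le (box_trans (box_trans px xz) zj); lra.
  have [Ki|nKi] := pselect (K i).
    have Xz : X z by exists i, j; split => //; exact: Kstep lij bj Ki.
    move: fxy; have -> : f x.
      apply/asboolP; exists z; split => //; rewrite boxC.
      by apply: box_le xz; lra.
    have -> // : f y.
    apply/asboolP; exists z; split => //; rewrite boxC in xz.
    by apply: box_le (box_trans xz xy); lra.
  have nKj : ~ K j by move=> Kj; apply: nKi; apply: Kstep Kj; rewrite 1?link_sym.
  have [w [[k [m [lkm Kk Km sw]]] wz]] : exists w, X w /\ box w (11 / 32) z.
    have [fx|nfx] := boolP (f x).
      have /asboolP[w [Xw wx]] := fx; exists w; split => //.
      by apply: box_le (box_trans wx xz); lra.
    have : f y by move: fxy; rewrite (negbTE nfx); case: (f y).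
    move=> /asboolP[w [Xw wy]]; exists w; split => //; rewrite boxC in xy.
    by apply: box_le (box_trans (box_trans wy xy) xz); lra.
  have ne a b : K a -> ~ K b -> a != b.
    by move=> Ka nKb; apply/eqP => ab; apply: nKb; rewrite -ab.
  have := edge_edge_sep lkm lij (ne _ _ Kk nKi) (ne _ _ Kk nKj)
    (ne _ _ Km nKi) (ne _ _ Km nKj) sw sz.
  by have := box_sqd wz; lra.
pose U z := exists b, box (c p) (l + 1) b /\ face b z.
have UM z : U z -> box (c p) (M - 3) z.
  move=> [b [pb bz]]; have bb : face b b.
    apply: connected_component_refl; case: bz => C [Cb CA _] _; exact: CA.
  have [v hv] := hrho b (connected_component_sub bb).
  have := hv _ bb; rewrite boxC => bv.
  apply: box_le (box_trans (box_trans pb bv) (hv _ bz)).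
  by rewrite /M; lra.
have [n [s [ps ls sn]]] := cG p q.
(* Lattice indices are natural numbers: the walk of [n] steps and the box of radius [l] must stay
   above and to the right of [o]. *)
pose o : R * R := ((c p).1 - (n%:R + l), (c p).2 - (n%:R + l)).
have n0 : 0 <= n%:R :> R by rewrite ler0n.
have ho r z : r <= n%:R + l -> box (c p) r z -> o.1 <= z.1 /\ o.2 <= z.2.
  by move=> hr /and4P[? ? ? ?]; rewrite /o /=; split; lra.
pose lat := lattice_pt o.
pose phi i j := f (lat i j); pose u i j := `[< U (lat i j) >].
have lath i j : box (lat i j) (1 / 32) (lat i.+1 j).
  by apply/and4P; rewrite /lat /lattice_pt /= -(natr1 i); split; lra.
have latv i j : box (lat i j) (1 / 32) (lat i j.+1).
  by apply/and4P; rewrite /lat /lattice_pt /= -(natr1 j); split; lra.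
pose Gh i j := (phi i j (+) phi i.+1 j) && u i j.
pose Gv i j := (phi i j (+) phi i j.+1) && u i j.
(* By [door] the box around a jump misses the graph and lies in one face, so a jump in [U] puts all
   corners of its square in [U], as [square_parity] requires. *)
have Uspread x y z : f x (+) f y -> box x (1 / 32) y -> U x ->
    box x (4 / 32) z -> U z.
  move=> fxy xy Ux xz; have hd := door x y (UM _ Ux) xy fxy.
  have [b [pb bx]] := Ux; exists b; split => //.
  apply: connected_component_trans bx _; apply: box_component hd _ xz.
  by rewrite boxxx //; lra.
have [g [gh gv]] : exists g : nat -> nat -> bool,
    (forall i j, g i.+1 j = g i j (+) Gh i j) /\
    (forall i j, g i j.+1 = g i j (+) Gv i j).
  apply: closed_cochain_exact => i j.
  have h1 := lath i j; have h2 := latv i j.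
  have h3 := lath i j.+1; have h4 := latv i.+1 j.
  have h5 := box_trans h1 h4.
  have h1' := h1; have h2' := h2; have h3' := h3; have h4' := h4.
  rewrite boxC in h1'; rewrite boxC in h2'; rewrite boxC in h3'.
  have h6 := box_trans h1' h2; have h7 := box_trans h2' h1.
  have le1 : (1 / 32 : R) <= 4 / 32 by lra.
  have le2 : (1 / 32 + 1 / 32 : R) <= 4 / 32 by lra.
  have uall : [|| Gh i j, Gv i.+1 j, Gv i j | Gh i j.+1] ->
      [&& u i j, u i.+1 j, u i j.+1 & u i.+1 j.+1].
    rewrite /Gh /Gv /u /phi.
    case/or4P=> /andP[d /asboolP Ux]; apply/and4P; split; apply/asboolP => //;
      (apply: Uspread d _ Ux _; [done|]);
      by [apply: box_le le1 _|apply: box_le le2 _].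
  exact: square_parity uall.
pose row := lattice_row o; pose col := lattice_col o.
have img z i j : embedded_image G z -> box z (3 / 32) (lat i j) ->
    (Gh i j = false) /\ (Gv i j = false).
  move=> Iz bz; rewrite boxC in bz.
  have bz4 : box (lat i j) (4 / 32) z by apply: box_le bz; lra.
  by split; apply/negP => /andP[d /asboolP Ux];
    apply: (door _ _ (UM _ Ux) _ d z bz4 Iz).
(* Near the graph no jump is in [U], so [g] is constant there; [r] grows by one with each edge and
   keeps the walk in the range of the lattice. *)
have gpath v t : path (adj G) v t -> forall r : R, r + (size t)%:R <= n%:R + l ->
    box (c p) r (c v) ->
    g (row (c v)) (col (c v)) = g (row (c (last v t))) (col (c (last v t))).
  elim: t v => [//|w t IH] v /= /andP[vw pt] r hr pv.
  have pw := box_trans pv (adj_box vw).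
  have pv1 : box (c p) (r + 1) (c v) by apply: box_le pv; lra.
  have t0 : 0 <= (size t)%:R :> R by rewrite ler0n.
  rewrite -natr1 in hr.
  rewrite -(IH w pt (r + 1)) //; last by lra.
  apply: (@locally_constant_segment _ (fun z => g (row z) (col z)) (1 / 32)).
    by rewrite divr_gt0.
  move=> z z' sz sz' bz.
  have rn : r + 1 <= n%:R + l by lra.
  have [lo1 lo2] := ho _ _ rn (box_convex pv1 pw sz).
  have [lo3 lo4] := ho _ _ rn (box_convex pv1 pw sz').
  have Iz : embedded_image G z by right; exists v, w.
  apply: lattice_constant => // i j bi _.
    by rewrite gh (img z i j Iz bi).1 addbF.
  by rewrite gv (img z i j Iz bi).2 addbF.
have gpq : g (row (c p)) (col (c p)) = g (row (c q)) (col (c q)).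
  rewrite (gpath p s ps 0) ?ls ?sn ?add0r ?boxxx //.
  by rewrite lerDl.
(* Near the segment every jump of [f] is in [U], so [g] jumps exactly when [f] does and their sum is
   constant. *)
have hpq : g (row (c p)) (col (c p)) (+) phi (row (c p)) (col (c p)) =
    g (row (c q)) (col (c q)) (+) phi (row (c q)) (col (c q)).
  apply: (@locally_constant_segment _
    (fun z => g (row z) (col z) (+) phi (row z) (col z)) (1 / 32)); first by lra.
  move=> z z' sz sz' bz.
  have ppl : box (c p) l (c p) by apply: boxxx.
  have pz := box_convex ppl pq sz.
  have ln : l <= n%:R + l by rewrite lerDr.
  have [lo1 lo2] := ho _ _ ln pz.
  have [lo3 lo4] := ho _ _ ln (box_convex ppl pq sz').
  have Ulat i j y : box z (3 / 32) (lat i j) -> box (lat i j) (1 / 32) y ->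
      f (lat i j) (+) f y -> u i j.
    move=> bi xy d; have pi := box_trans pz bi; apply/asboolP; exists (lat i j).
    split; first by apply: box_le pi; lra.
    apply: connected_component_refl; apply: (door _ y _ xy d).
      by apply: box_le pi; rewrite /M; lra.
    by apply: boxxx; lra.
  apply: (@lattice_constant _ o (fun i j => g i j (+) phi i j)) => // i j bi _.
    have := Ulat i j _ bi (lath i j); rewrite gh /Gh -/(phi i j) -/(phi i.+1 j).
    by case: (u i j) (phi i j) (phi i.+1 j) (g i j) => [] [] [] [] // /(_ isT).
  have := Ulat i j _ bi (latv i j); rewrite gv /Gv -/(phi i j) -/(phi i j.+1).
  by case: (u i j) (phi i j) (phi i j.+1) (g i j) => [] [] [] [] // /(_ isT).
have latz z : box (c p) l z -> box z (1 / 32) (lat (row z) (col z)).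
  move=> pz; have ln : l <= n%:R + l by rewrite lerDr.
  have [lo1 lo2] := ho _ _ ln pz.
  exact: lattice_near.
have phip : phi (row (c p)) (col (c p)).
  apply/asboolP; exists (c p); split.
    by exists p, p; rewrite /link eqxx; split => //; exact: segment_left.
  by apply: box_le (latz _ (boxxx _ l0)); lra.
have phiq : ~~ phi (row (c q)) (col (c q)).
  apply/asboolP => -[w [[k [m [lkm Kk Km sw]]] wz]].
  have := latz _ pq; rewrite boxC => zq; have wq := box_trans wz zq.
  have ne a : K a -> q != a by move=> Ka; apply/eqP => qa; apply: nKq; rewrite qa.
  have := vertex_edge_sep lkm (ne _ Kk) (ne _ Km) sw.
  by have := box_sqd wq; rewrite sqdC; lra.
by move: hpq; rewrite gpq phip (negbTE phiq); case: (g _ _).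
Qed.

End LocalConnectivity.

(** * Rough isometry with a lattice *)

(** Vertices chosen within [L] of two points at distance at most [L] are at most [3 * L] apart,
    within the range [4 * L]. Confinement by [M] is what later bounds the overlap of energies. *)
Definition coarse_grid (R : realType) (G : penny_graph R) (L M : R) (N : nat) :=
  (forall p, exists x, box p L (Defs.center G x)) /\
  (forall x y, box (Defs.center G x) (4 * L) (Defs.center G y) ->
    exists s, [/\ path (adj G) x s, last x s = y, (size s <= N)%N
      & all (fun w => box (Defs.center G x) M (Defs.center G w)) (x :: s)]).

(** [M] comes from [local_connectivity] with [l = 4 * L] and [rho = L]. Once shortened to have no
    repetition, the path has no more vertices than the box of radius [M] can hold. *)
Lemma bounded_faces_coarse_grid (R : realType) (D : R) (L := face_radius D)
    (M := 6 * L + 5) (G : penny_graph R) :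
  graph_connected G ->
  (forall sigma, faces G sigma -> (facial_degree G sigma <= D%:E)%E) ->
  coarse_grid G L M (packing M).
Proof.
move=> cG hD; split; first exact: near_vertex.
move=> x y xy.
have L0 : 0 <= L by rewrite mulr_ge0.
have [|s [ps ls als]] := local_connectivity _ L0 cG (face_bounded cG hD) xy.
  by rewrite mulr_ge0.
case/shortenP: ps ls als => t pt ut st lt als.
have alt : all (fun w => box (Defs.center G x) M (Defs.center G w)) (x :: t).
  apply/allP => w; rewrite inE => hw; have /allP := als => /(_ w).
  rewrite inE; have -> : (w == x) || (w \in s).
    by case/orP: hw => [->//|/st ->]; rewrite orbT.
  by move=> /(_ isT); rewrite (_ : 4 * L + 2 * L + 5 = M) // /M; ring.
exists t; split => //; apply: leq_trans (leqnSn _) _.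
apply: (packing_bound (@center_box_sep R G) (p := Defs.center G x) (s := x :: t)) => //.
exact/allP.
Qed.

(** Each step of the induction moves [q] towards [x0] by at most [L] and costs at most [N] edges. *)
Lemma coarse_grid_walk (R : realType) (G : penny_graph R) (L M : R) (N : nat)
    (x0 : nat) (n : nat) (q : R * R) :
  0 < L -> coarse_grid G L M N ->
  box (Defs.center G x0) (n%:R * L) q ->
  exists z, box q L (Defs.center G z) /\
    exists2 m, (m <= N * n)%N & walk_length G z x0 m.
Proof.
move=> L0 [near joined]; elim: n q => [|n IH] q.
  rewrite mul0r => /and4P[q1 q2 q3 q4]; exists x0; split.
    by apply/and4P; split; lra.
  by exists 0%N => //; exists [::].
set p := Defs.center G x0 => pq.
pose t : R := n%:R / n.+1%:R.
have n1 : 0 < n.+1%:R :> R by rewrite ltr0n.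
have step (a b : R) : a - n.+1%:R * L <= b -> b <= a + n.+1%:R * L ->
    [/\ a - n%:R * L <= line_path a b t, line_path a b t <= a + n%:R * L,
        b - L <= line_path a b t & line_path a b t <= b + L].
  have -> : line_path a b t = a + n%:R * ((b - a) / n.+1%:R).
    by rewrite /line_path /t -natr1; field; rewrite natr1 gt_eqF.
  move=> h1 h2.
  have eb : b = a + n%:R * ((b - a) / n.+1%:R) + (b - a) / n.+1%:R.
    by rewrite -natr1; field; rewrite natr1 gt_eqF.
  have : - L <= (b - a) / n.+1%:R by rewrite ler_pdivlMr //; lra.
  have : (b - a) / n.+1%:R <= L by rewrite ler_pdivrMr //; lra.
  have : 0 <= n%:R :> R by rewrite ler0n.
  move: ((b - a) / _) eb => d eb n0 d1 d2; rewrite eb; split; nra.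
have [z qz] := near q.
case/and4P: pq => h1 h2 h3 h4.
have [a1 a2 a3 a4] := step _ _ h1 h2; have [b1 b2 b3 b4] := step _ _ h3 h4.
have [|z' [qz' [m mN [s [ps ls sm]]]]] := IH (line_path p.1 q.1 t, line_path p.2 q.2 t).
  by apply/and4P; split.
exists z; split => //.
have [|s' [ps' ls' ss' _]] := joined z z'.
  by move: qz qz' => /and4P[? ? ? ?] /= /and4P[/= ? ? ? ?]; apply/and4P; split; lra.
exists (size s' + m)%N; first by rewrite mulnS leq_add.
by exists (s' ++ s); rewrite cat_path last_cat ps' ls' ps ls size_cat sm.
Qed.

Lemma graph_dist_le (R : realType) (G : penny_graph R) (x y m : nat) :
  walk_length G x y m -> (graph_dist G x y <= m)%N.
Proof.
move=> w; rewrite /graph_dist.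
have ex : exists n, `[< walk_length G x y n >] by exists m; apply/asboolP.
have [n /asboolP wn minn] := ex_minnP ex.
have : [set n | walk_length G x y n /\
    forall m, walk_length G x y m -> (n <= m)%N] n.
  by split => // k wk; apply: minn; apply/asboolP.
by move=> /(xgetI 0%N) [_ h]; apply: h.
Qed.

(** Turns growth in the graph distance into growth in the plane. At most [r + 1] steps and one more
    to reach [x] give the length [N * (r + 2)]. *)
Lemma coarse_grid_dist (R : realType) (G : penny_graph R) (L M : R) (N : nat)
    (x0 x : nat) (r : R) :
  1 <= L -> 1 <= r -> coarse_grid G L M N ->
  box (Defs.center G x0) r (Defs.center G x) ->
  (graph_dist G x x0)%:R <= 3 * N%:R * r.
Proof.
move=> L1 r1 cg bx; have L0 : 0 < L by lra.
pose n := (Num.truncn r).+1.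
have /andP[n1 n2] : n%:R - 1 <= r < n%:R.
  have /truncn_itv/andP[h1 h2] : 0 <= r by lra.
  by rewrite /n h2 -natr1 addrK h1.
have [|z [xz [m mN [s [ps ls sm]]]]] :=
    coarse_grid_walk (x0 := x0) (n := n) (q := Defs.center G x) L0 cg.
  by apply: box_le bx; nra.
have [_ joined] := cg; have [|s' [ps' ls' ss' _]] := joined x z.
  by apply: box_le xz; lra.
have : (graph_dist G x x0 <= N * n.+1)%N.
  apply: leq_trans (graph_dist_le (m := size s' + m) _) _.
    by exists (s' ++ s); rewrite cat_path last_cat ps' ls' ps ls size_cat sm.
  by rewrite mulnS leq_add.
rewrite -(ler_nat R) natrM -natr1 => /le_trans; apply.
have N0 : 0 <= N%:R :> R by rewrite ler0n.
nra.
Qed.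

(** * Gram determinants and dimension *)

Section GramDeterminant.
Variable R : realFieldType.

Definition qform n (A : 'M[R]_n) (u : 'rV_n) : R := (u *m A *m u^T) 0 0.

Lemma qform_congr n (A P : 'M[R]_n) u :
  qform (P *m A *m P^T) u = qform A (u *m P).
Proof. by rewrite /qform trmx_mul !mulmxA. Qed.

(** Completing the square: [(1, w)] is orthogonal to every [(0, v)]. If the lower block is positive,
    [s] is the minimum of the form on vectors with first coordinate 1. *)
Lemma schur_complement n (A : 'M[R]_(1 + n)) : A^T = A ->
  drsubmx A \in unitmx ->
  exists (s : R) (w : 'rV_n),
    [/\ \det A = s * \det (drsubmx A), s = qform A (row_mx 1 w) &
        forall v, qform A (row_mx 1 v) = s + qform (drsubmx A) (v - w)].
Proof.
move=> sA; set D := drsubmx A => uD.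
set b := ursubmx A; set g := ulsubmx A.
have eb : dlsubmx A = b^T by rewrite /b trmx_ursub sA.
have eA : A = block_mx g b b^T D by rewrite -eb submxK.
pose w := - (b *m invmx D).
have wD : w *m D = - b by rewrite mulNmx mulmxKV.
have eq1 : row_mx 1 w *m A = row_mx (g + w *m b^T) 0.
  by rewrite eA mul_row_block !mul1mx wD subrr.
exists ((g + w *m b^T) 0 0), w; split.
- have e2 : block_mx 1 w 0 1%:M *m A = block_mx (g + w *m b^T) 0 b^T D.
    by rewrite eA mulmx_block !mul1mx wD subrr !mul0mx !add0r.
  have := congr1 determinant e2.
  by rewrite det_mulmx det_ublock !det1 !mul1r det_lblock [X in _ = X * _]det_mx11.
- by rewrite /qform eq1 tr_row_mx mul_row_col mul0mx addr0 trmx1 mulmx1.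
move=> v; rewrite /qform.
have -> : row_mx 1 v = row_mx 1 w + row_mx 0 (v - w) :> 'rV[R]_(1 + n).
  by rewrite add_row_mx addr0 addrC subrK.
move: (v - w) => z.
have eq2 : A *m (row_mx 1 w)^T = col_mx (g + w *m b^T)^T 0.
  by rewrite -[in LHS]sA -trmx_mul eq1 tr_row_mx trmx0.
rewrite linearD /= mulmxDl mulmxDr !mulmxDl.
have -> : row_mx 0 z *m A *m (row_mx 1 w)^T = 0.
  by rewrite -mulmxA eq2 mul_row_col mul0mx mulmx0 addr0.
have -> : row_mx 1 w *m A *m (row_mx 0 z)^T = 0.
  by rewrite eq1 tr_row_mx mul_row_col trmx0 mulmx0 mul0mx addr0.
have -> : row_mx 1 w *m A *m (row_mx 1 w)^T = g + w *m b^T.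
  by rewrite eq1 tr_row_mx mul_row_col mul0mx addr0 trmx1 mulmx1.
have -> : row_mx 0 z *m A *m (row_mx 0 z)^T
    = z *m D *m z^T.
  rewrite {1}eA mul_row_block !mul0mx !add0r tr_row_mx mul_row_col trmx0 mulmx0.
  by rewrite add0r.
by rewrite addr0 add0r mxE.
Qed.

Lemma qform_drsub n (A : 'M[R]_(1 + n)) u :
  qform (drsubmx A) u = qform A (row_mx 0 u).
Proof.
rewrite /qform -{2}(submxK A) mul_row_block !mul0mx !add0r tr_row_mx mul_row_col.
by rewrite trmx0 mulmx0 add0r.
Qed.

(** Induction on the first coordinate: the Schur complements [s] and [t] are minima of the two
    forms, and testing the first form at the minimizer of the second gives [s <= t]. Once [r] is 0
    every vector is contracted, and each comparison gains [delta]. *)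
Lemma det_le_coordinates n r (delta : R) (A B : 'M[R]_n) :
  0 <= delta -> A^T = A -> B^T = B ->
  (forall u : 'rV_n, u != 0 -> 0 < qform A u) -> (forall u, qform A u <= qform B u) ->
  (forall u : 'rV_n, (forall i : 'I_n, (i < r)%N -> u 0 i = 0) ->
     qform A u <= delta * qform B u) ->
  0 < \det A <= delta ^+ (n - r) * \det B.
Proof.
move=> d0; elim: n r A B => [|n IH] r A B sA sB pA AB AdB.
  by rewrite !det_mx00 sub0n expr0 mulr1 ltr01 lexx.
move: A B sA sB pA AB AdB; rewrite -[n.+1]/(1 + n)%N => A B sA sB pA AB AdB.
have row0 u : u != 0 -> row_mx 0 u != 0 :> 'rV[R]_(1 + n).
  by apply: contra_neq; rewrite -(row_mx0 _ 1 1 n) => /eq_row_mx[].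
have sDA : (drsubmx A)^T = drsubmx A by rewrite trmx_drsub sA.
have sDB : (drsubmx B)^T = drsubmx B by rewrite trmx_drsub sB.
have pD u : u != 0 -> 0 < qform (drsubmx A) u.
  by move=> /row0 un; rewrite qform_drsub pA.
have pB u : u != 0 -> 0 < qform B u by move=> /pA h; apply: lt_le_trans h (AB u).
have DD u : qform (drsubmx A) u <= qform (drsubmx B) u by rewrite !qform_drsub.
have qf0 m (C : 'M[R]_m) : qform C 0 = 0 by rewrite /qform !mul0mx mxE.
have pDB u : 0 <= qform (drsubmx B) u.
  have [->|un] := eqVneq u 0; first by rewrite qf0.
  by apply/ltW/(lt_le_trans (pD u un)).
have pDA u : 0 <= qform (drsubmx A) u.
  have [->|un] := eqVneq u 0; first by rewrite qf0.
  exact/ltW/pD.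
have /andP[dA dAB] : 0 < \det (drsubmx A) <=
    delta ^+ (n - r.-1) * \det (drsubmx B).
  apply: IH => // u hu; rewrite !qform_drsub; apply: AdB => i.
  case: (split_ordP i) => j ->; first by rewrite row_mxEl mxE.
  rewrite row_mxEr /= add1n => jr; apply: hu; by case: (r) jr.
have pDBp u : u != 0 -> 0 < qform (drsubmx B) u.
  by move=> un; apply/(lt_le_trans (pD u un)).
(* [IH] with the same matrix twice and [r = n] yields positivity of its determinant. *)
have /andP[dB _] : 0 < \det (drsubmx B) <= delta ^+ (n - n) * \det (drsubmx B).
  apply: IH => // u hu; suff -> : u = 0 by rewrite !qf0 mulr0.
  by apply/rowP => i; rewrite hu // mxE.
have unitD (C : 'M[R]_n) : 0 < \det C -> C \in unitmx.
  by move=> h; rewrite unitmxE unitfE gt_eqF.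
have [s [w [-> es ms]]] := schur_complement sA (unitD _ dA).
have [t [w' [-> et mt]]] := schur_complement sB (unitD _ dB).
have row1 v : row_mx 1 v != 0 :> 'rV[R]_(1 + n).
  rewrite -(row_mx0 _ 1 1 n); apply/eqP => /eq_row_mx[/matrixP/(_ 0 0)/eqP].
  by rewrite !mxE /= oner_eq0.
have s0 : 0 < s by rewrite es pA.
have sw' : s <= qform A (row_mx 1 w') by rewrite ms lerDl.
have st : s <= delta ^+ (r == 0)%N * t.
  apply: le_trans sw' _; rewrite et; case: eqP => r0; last by rewrite mul1r.
  by apply: AdB => i; rewrite r0.
rewrite mulr_gt0 //=.
have -> : (n.+1 - r = (r == 0) + (n - r.-1))%N.
  by case: (r) => [|r'] /=; rewrite ?subn0 ?subSS.
rewrite exprD mulrACA; apply: ler_pM => //; exact: ltW.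
Qed.

(** In the coordinates given by [col_ebase K], the kernel consists of the vectors whose first
    [\rank K] coordinates vanish, and both determinants change by the same positive factor. As
    [delta <= 1], the rank may be replaced by [m]. *)
Lemma det_le_kernel n m (delta : R) (A B : 'M[R]_n) (K : 'M[R]_(n, m)) :
  0 <= delta <= 1 -> A^T = A -> B^T = B ->
  (forall u : 'rV_n, u != 0 -> 0 < qform A u) -> (forall u, qform A u <= qform B u) ->
  (forall u : 'rV_n, u *m K = 0 -> qform A u <= delta * qform B u) ->
  0 < \det A <= delta ^+ (n - m) * \det B.
Proof.
move=> /andP[d0 d1] sA sB pA AB AdB.
pose P := invmx (col_ebase K).
have uP : P \in unitmx by rewrite unitmx_inv col_ebase_unit.
have dP : 0 < \det P ^+ 2.
  by rewrite lt_def sqr_ge0 sqrf_eq0 -unitfE -unitmxE uP.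
have detP C : \det (P *m C *m P^T) = \det P ^+ 2 * \det C.
  by rewrite !det_mulmx det_tr mulrAC expr2.
have symP C : C^T = C -> (P *m C *m P^T)^T = P *m C *m P^T.
  by move=> sC; rewrite !trmx_mul trmxK sC mulmxA.
have /andP[dA dAB] : 0 < \det (P *m A *m P^T) <=
    delta ^+ (n - \rank K) * \det (P *m B *m P^T).
  apply: det_le_coordinates => //; try exact: symP; move=> u.
  - move=> un; rewrite qform_congr pA //; apply: contra_neq un => e.
    by rewrite -[u](mulmxK uP) e mul0mx.
  - by rewrite !qform_congr.
  - move=> hu; rewrite !qform_congr; apply: AdB.
    rewrite -{1}(mulmx_ebase K) !mulmxA mulmxKV ?col_ebase_unit //.
    suff -> : u *m pid_mx (\rank K) = 0 :> 'rV_m by rewrite mul0mx.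
    apply/rowP => j; rewrite !mxE big1 // => i _; rewrite mxE.
    by case: ltnP => hi; rewrite ?andbF ?mulr0 // hu // mul0r.
rewrite !detP in dA dAB; rewrite pmulr_rgt0 // in dA.
rewrite dA mulrCA ler_pM2l // in dAB *; apply: le_trans dAB _.
have dB : 0 <= \det B.
  suff /andP[/ltW] : 0 < \det B <= delta ^+ (n - n) * \det B by [].
  apply: det_le_coordinates => // u; first by move=> /pA h; apply: lt_le_trans h (AB u).
  move=> hu; suff -> : u = 0 by rewrite /qform !mul0mx mxE mulr0.
  by apply/rowP => i; rewrite hu // mxE.
by apply: ler_wpM2r => //; apply: ler_wiXn2l => //; rewrite leq_sub2l // rank_leq_col.
Qed.

End GramDeterminant.

(** * Independent families and dimension *)

Section Dimension.
Variable R : realType.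

Definition independent (T : Type) n (b : 'I_n -> T -> R) : Prop :=
  forall a : 'I_n -> R, (forall x, \sum_(i < n) a i * b i x = 0) ->
    forall i, a i = 0.

(** The points are chosen to maximize the rank of the evaluation matrix: adding a point where some
    combination vanishing on them is nonzero would increase it. This makes Gram matrices over large
    boxes positive definite. *)
Lemma independent_evaluation (T : Type) (x0 : T) n (b : 'I_n -> T -> R) :
  independent b ->
  exists s : seq T, forall a : 'I_n -> R,
    (forall j : nat, (j < size s)%N -> \sum_(i < n) a i * b i (nth x0 s j) = 0) ->
    forall i, a i = 0.
Proof.
move=> ib.
pose ev (s : seq T) : 'M[R]_(n, size s) := \matrix_(i, j) b i (nth x0 s j).
pose P k := `[< exists s, \rank (ev s) = k >].
have exP : exists k, P k by exists (\rank (ev [::])); apply/asboolP; exists [::].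
have bP k : P k -> (k <= n)%N by move=> /asboolP[s <-]; exact: rank_leq_row.
have [k /asboolP[s ks] maxk] := ex_maxnP exP bP.
exists s => a ha; apply: ib => x; apply/eqP; apply: contraT => nz.
have evE (t : seq T) (u : 'rV_n) j : (u *m ev t) 0 j = \sum_i u 0 i * b i (nth x0 t j).
  by rewrite mxE; apply: eq_bigr => i _; rewrite mxE.
have le : (kermx (ev (x :: s)) <= kermx (ev s))%MS.
  apply/row_subP => i; set u := row i _.
  have /sub_kermxP hu : (u <= kermx (ev (x :: s)))%MS by exact: row_sub.
  apply/sub_kermxP/rowP => j; rewrite evE mxE.
  have := congr1 (fun v : 'rV_(size (x :: s)) => v 0 (lift ord0 j)) hu.
  by rewrite evE mxE.
pose u := \row_i a i.
have us : (u <= kermx (ev s))%MS.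
  apply/sub_kermxP/rowP => j; rewrite evE mxE -[RHS](ha j) //.
  by apply: eq_bigr => i _; rewrite mxE.
have uns : ~~ (u <= kermx (ev (x :: s)))%MS.
  apply: contra nz => /sub_kermxP hu.
  have := congr1 (fun v : 'rV_(size (x :: s)) => v 0 ord0) hu.
  rewrite evE mxE /= => e; apply/eqP; rewrite -[RHS]e.
  by apply: eq_bigr => i _; rewrite mxE.
have lt : (kermx (ev (x :: s)) < kermx (ev s))%MS.
  rewrite ltmxE le /=; apply: contra uns; exact: submx_trans.
move: lt; rewrite ltmxErank le !mxrank_ker /= => lt.
have : (\rank (ev (x :: s)) <= k)%N by apply: maxk; apply/asboolP; exists (x :: s).
by rewrite -ks => /(leq_sub2l n); rewrite leqNgt lt.
Qed.

(** An independent family of largest size in [W] is a basis: adding any [u] creates a relation, in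
    which the coefficient of [u] is nonzero. *)
Lemma dimension_le (T : Type) (W : set (T -> R)) (m : nat) :
  (forall n (b : 'I_n -> T -> R), (forall i, W (b i)) -> independent b ->
     (n <= m)%N) ->
  (dimension W <= (m%:R)%:E)%E.
Proof.
move=> hW.
pose P n := `[< exists b : 'I_n -> T -> R, (forall i, W (b i)) /\ independent b >].
have exP : exists n, P n.
  exists 0%N; apply/asboolP; exists (fun i _ => 0).
  by split=> [[]|a _ []].
have bP n : P n -> (n <= m)%N by move=> /asboolP[b [Wb ib]]; apply: hW ib.
have [n Pn maxn] := ex_maxnP exP bP.
have nm := bP n Pn; move: Pn => /asboolP[b [Wb ib]].
apply: (@le_trans _ _ ((n%:R)%:E)); last by rewrite lee_fin ler_nat.
apply: ereal_inf_lbound; exists n => //; exists b; split => // u Wu.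
pose b' (i : 'I_n.+1) := if unlift ord_max i is Some j then b j else u.
have nib : ~ independent b'.
  move=> ib'; have : P n.+1.
    apply/asboolP; exists b'; split => // i; rewrite /b'.
    by case: unliftP => [j|] _.
  by move=> /maxn; rewrite ltnn.
have [a ha [i hi]] : exists2 a : 'I_n.+1 -> R,
    forall x, \sum_i a i * b' i x = 0 & exists i, a i != 0.
  apply: contrapT => h; apply: nib => a ha i; apply/eqP; apply: contraT => ai.
  by exfalso; apply: h; exists a => //; exists i.
have E x : \sum_(j < n) a (lift ord_max j) * b j x + a ord_max * u x = 0.
  rewrite -[RHS](ha x) (bigD1 ord_max) // addrC; congr (_ + _).
    by rewrite /b' unlift_none.
  rewrite (reindex_omap (lift ord_max) (unlift ord_max)) /=.
    apply: eq_big => [j|j _]; last by rewrite /b' liftK.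
    by rewrite liftK eqxx andbT eq_sym neq_lift.
  by move=> j; case: unliftP => [j' ->|->]; rewrite ?eqxx.
have am : a ord_max != 0.
  apply/eqP => a0; move: hi; apply/negP; rewrite negbK.
  have := ib (fun j => a (lift ord_max j)); move=> ib0.
  case: (unliftP ord_max i) => [j ->|->]; last by rewrite a0.
  rewrite ib0 // => x; have := E x; by rewrite a0 mul0r addr0.
exists (fun j => - a (lift ord_max j) / a ord_max) => x.
apply: (mulfI am); rewrite big_distrr /=.
have -> : a ord_max * u x = - \sum_(j < n) a (lift ord_max j) * b j x.
  by apply/eqP; rewrite -addr_eq0 addrC E.
rewrite -sumrN; apply: eq_bigr => j _; field; exact: am.
Qed.

End Dimension.

(** * Sums and discrete Poincare inequality *)

Section FiniteSums.
Variable R : realFieldType.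

Lemma ler_sum_uniq (T : eqType) (s t : seq T) (F : T -> R) :
  uniq s -> uniq t -> {subset s <= t} -> (forall x, 0 <= F x) ->
  \sum_(x <- s) F x <= \sum_(x <- t) F x.
Proof.
move=> us ut st F0.
have -> : \sum_(x <- s) F x = \sum_(x <- t | x \in s) F x.
  rewrite -[RHS]big_filter; apply: perm_big; apply: uniq_perm => //.
    exact: filter_uniq.
  by move=> x; rewrite mem_filter; case: (boolP (x \in s)) => //= /st ->.
rewrite big_mkcond /=; apply: ler_sum => x _.
by case: ifP.
Qed.

Lemma ler_sum_cover (T : eqType) (I : finType) (s : seq T) (t : I -> seq T)
    (F : T -> R) :
  uniq s -> (forall i, uniq (t i)) -> (forall x, 0 <= F x) ->
  (forall x, x \in s -> exists i, x \in t i) ->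
  \sum_(x <- s) F x <= \sum_i \sum_(x <- t i) F x.
Proof.
move=> us ut F0 cov.
apply: (@le_trans _ _ (\sum_(x <- s) \sum_(i | x \in t i) F x)).
  rewrite big_seq [leRHS]big_seq; apply: ler_sum => x /cov [i xi].
  by rewrite (bigD1 i) //= lerDl sumr_ge0.
rewrite (exchange_big_dep xpredT) //=; apply: ler_sum => i _.
rewrite -big_filter; apply: ler_sum_uniq => //; first exact: filter_uniq.
by move=> x; rewrite mem_filter => /andP[].
Qed.

(** The variance, written over pairs. It yields Cauchy-Schwarz and, for zero sums, the inequality on
    squares. *)
Lemma sum_sqr_diff (I : finType) (a : I -> R) :
  \sum_i \sum_j (a i - a j) ^+ 2 =
  2 * #|I|%:R * (\sum_i a i ^+ 2) - 2 * (\sum_i a i) ^+ 2.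
Proof.
set Q := \sum_i a i ^+ 2; set S := \sum_i a i.
have -> : \sum_i \sum_j (a i - a j) ^+ 2 =
    \sum_i (#|I|%:R * a i ^+ 2 + Q - 2 * a i * S).
  apply: eq_bigr => i _.
  have -> : \sum_j (a i - a j) ^+ 2 = \sum_j (a i ^+ 2 + a j ^+ 2 - 2 * a i * a j).
    by apply: eq_bigr => j _; ring.
  by rewrite sumrB big_split /= sumr_const -mulr_sumr -[a i ^+ 2 *+ _]mulr_natl.
rewrite sumrB big_split /= sumr_const -mulr_sumr -mulr_suml -mulr_sumr -/S -/Q.
by rewrite -[Q *+ _]mulr_natl; ring.
Qed.

Lemma sqr_sum_le n (d : nat -> R) :
  (\sum_(i < n) d i) ^+ 2 <= n%:R * \sum_(i < n) d i ^+ 2.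
Proof.
have := sum_sqr_diff (fun i : 'I_n => d i); rewrite card_ord => h.
have : 0 <= \sum_(i < n) \sum_(j < n) (d i - d j) ^+ 2.
  by apply: sumr_ge0 => i _; apply: sumr_ge0 => j _; exact: sqr_ge0.
by rewrite h; lra.
Qed.

Lemma sqr_diff_le h (f : nat -> R) i j : (i < h)%N -> (j < h)%N ->
  (f i - f j) ^+ 2 <= h%:R * \sum_(t < h) (f t.+1 - f t) ^+ 2.
Proof.
wlog ij : i j / (i <= j)%N.
  move=> H ih jh; have [/H|/ltnW/H] := leqP i j; first exact.
  by rewrite -sqrrN opprB; exact.
move=> ih jh.
(* Clamping the argument between [i] and [j] lets the telescoping sum run over all of [0 .. h]. *)
pose g t := f (maxn i (minn t j)).
have step t : (g t.+1 - g t) ^+ 2 <= (f t.+1 - f t) ^+ 2.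
  rewrite /g; have [ti|it] := ltnP t i.
    rewrite (minn_idPl (leq_trans ti ij)) (minn_idPl (leq_trans (ltnW ti) ij)).
    by rewrite (maxn_idPl ti) (maxn_idPl (ltnW ti)) subrr expr0n sqr_ge0.
  have [tj|jt] := ltnP t j.
    by rewrite (minn_idPl tj) !(maxn_idPr _) // ltnW.
  by rewrite (minn_idPr (leqW jt)) subrr expr0n sqr_ge0.
have -> : f i - f j = - \sum_(t < h) (g t.+1 - g t).
  rewrite -(big_mkord xpredT (fun t => g t.+1 - g t)) telescope_sumr // /g.
  rewrite min0n maxn0 (minn_idPr (ltnW jh)) (maxn_idPr ij); ring.
rewrite sqrrN; apply: le_trans (sqr_sum_le _ (fun t => g t.+1 - g t)) _.
by apply: ler_wpM2l => //; apply: ler_sum.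
Qed.

(* The difference between two values is estimated along the path that changes
   first one coordinate and then the other. *)
Lemma square_poincare h (a : nat -> nat -> R) :
  \sum_(i < h) \sum_(j < h) a i j = 0 ->
  \sum_(i < h) \sum_(j < h) a i j ^+ 2 <=
  h%:R ^+ 2 * \sum_(i < h) \sum_(j < h)
    ((a i.+1 j - a i j) ^+ 2 + (a i j.+1 - a i j) ^+ 2).
Proof.
case: h => [|h] a0; first by rewrite !big_ord0 mulr0.
pose b (p : 'I_h.+1 * 'I_h.+1) := a p.1 p.2.
pose D1 := \sum_(j < h.+1) \sum_(t < h.+1) (a t.+1 j - a t j) ^+ 2.
pose D2 := \sum_(i < h.+1) \sum_(t < h.+1) (a i t.+1 - a i t) ^+ 2.
have b0 : \sum_p b p = 0 by rewrite -[RHS]a0 pair_bigA.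
have := sum_sqr_diff b; rewrite b0 expr0n mulr0 subr0 card_prod card_ord.
have -> : \sum_p b p ^+ 2 = \sum_(i < h.+1) \sum_(j < h.+1) a i j ^+ 2.
  by rewrite pair_bigA.
set S := \sum_(i < h.+1) \sum_(j < h.+1) a i j ^+ 2 => eS.
have -> : \sum_(i < h.+1) \sum_(j < h.+1)
    ((a i.+1 j - a i j) ^+ 2 + (a i j.+1 - a i j) ^+ 2) = D1 + D2.
  by under eq_bigr do rewrite big_split /=; rewrite big_split /= exchange_big.
set n : R := h.+1%:R; have n0 : 0 < n by rewrite ltr0n.
have E1 : \sum_p \sum_q (b p - b q) ^+ 2 <= \sum_(p : 'I_h.+1 * 'I_h.+1)
   \sum_(q : 'I_h.+1 * 'I_h.+1)
     (2 * n * (\sum_(t < h.+1) (a t.+1 p.2 - a t p.2) ^+ 2)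
    + 2 * n * (\sum_(t < h.+1) (a q.1 t.+1 - a q.1 t) ^+ 2)).
  apply: ler_sum => -[i j] _; apply: ler_sum => -[i' j'] _; rewrite /b /=.
  have h1 := sqr_diff_le (a ^~ j) (ltn_ord i) (ltn_ord i').
  have h2 := sqr_diff_le (a i') (ltn_ord j) (ltn_ord j').
  have := sqr_ge0 ((a i j - a i' j) - (a i' j - a i' j')).
  rewrite -/n in h1 h2; rewrite -!mulrA; lra.
have E2 : \sum_(p : 'I_h.+1 * 'I_h.+1) \sum_(q : 'I_h.+1 * 'I_h.+1)
     (2 * n * (\sum_(t < h.+1) (a t.+1 p.2 - a t p.2) ^+ 2)
    + 2 * n * (\sum_(t < h.+1) (a q.1 t.+1 - a q.1 t) ^+ 2))
    = 2 * n ^+ 4 * (D1 + D2).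
  under eq_bigr do rewrite big_split /=; rewrite big_split /=.
  rewrite [X in X + _]exchange_big /= !sumr_const !card_prod !card_ord.
  have -> : \sum_(p : 'I_h.+1 * 'I_h.+1)
      2 * n * (\sum_(t < h.+1) (a t.+1 p.2 - a t p.2) ^+ 2) = 2 * n * (n * D1).
    rewrite -mulr_sumr -(pair_bigA _ (fun i j : 'I_h.+1 =>
      \sum_(t < h.+1) (a t.+1 j - a t j) ^+ 2)) /=.
    by rewrite sumr_const card_ord -[D1 *+ _]mulr_natl.
  have -> : \sum_(q : 'I_h.+1 * 'I_h.+1)
      2 * n * (\sum_(t < h.+1) (a q.1 t.+1 - a q.1 t) ^+ 2) = 2 * n * (n * D2).
    rewrite -mulr_sumr -(pair_bigA _ (fun i j : 'I_h.+1 =>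
      \sum_(t < h.+1) (a i t.+1 - a i t) ^+ 2)) /=.
    under eq_bigr do rewrite sumr_const card_ord.
    by rewrite sumrMnl -[D2 *+ _]mulr_natl.
  by rewrite -!(mulr_natl (2 * n * _)) natrM -/n; ring.
have : 2 * n ^+ 2 * S <= 2 * n ^+ 2 * (n ^+ 2 * (D1 + D2)).
  move: eS; rewrite natrM -/n -expr2 => <-; apply: le_trans E1 _.
  by rewrite E2 le_eqVlt; apply/orP; left; apply/eqP; ring.
by rewrite ler_pM2l // mulr_gt0 // exprn_gt0.
Qed.

End FiniteSums.

(** * Caccioppoli inequality *)

Section Caccioppoli.
Variables (R : realType) (G : penny_graph R).
Local Notation c := (Defs.center G).

Definition nbrs x : seq nat := [seq y <- vbox G (c x) 1 | adj G x y].

Lemma mem_nbrs x y : (y \in nbrs x) = adj G x y.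
Proof.
rewrite mem_filter mem_vbox; case: (boolP (adj G x y)) => // xy.
exact: adj_box.
Qed.

Lemma nbrs_uniq x : uniq (nbrs x).
Proof. by rewrite filter_uniq // vbox_uniq. Qed.

Lemma laplacian_nbrs u x : laplacian G u x = \sum_(y <- nbrs x) (u y - u x).
Proof.
rewrite fsbig_seq ?nbrs_uniq // /laplacian.
suff -> : [set y | adj G x y] = [set` nbrs x] by [].
by apply/seteqP; split => y /=; rewrite mem_nbrs.
Qed.

Definition energy (u : nat -> R) x : R := \sum_(y <- nbrs x) (u y - u x) ^+ 2.

Lemma energy_ge0 u x : 0 <= energy u x.
Proof. by apply: sumr_ge0 => y _; exact: sqr_ge0. Qed.

Lemma adj_sqr_le_energy u x y : adj G x y -> (u y - u x) ^+ 2 <= energy u x.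
Proof.
move=> xy; rewrite /energy (bigD1_seq y) ?mem_nbrs ?nbrs_uniq //=.
by rewrite lerDl sumr_ge0 // => z _; exact: sqr_ge0.
Qed.

Lemma sum_vbox_nbrs (F : nat -> R) (p : R * R) r x : box p r (c x) ->
  \sum_(y <- vbox G p (r + 1) | adj G x y) F y = \sum_(y <- nbrs x) F y.
Proof.
move=> px; rewrite -big_filter; apply: perm_big; apply: uniq_perm.
- by rewrite filter_uniq // vbox_uniq.
- exact: nbrs_uniq.
move=> y; rewrite mem_filter mem_nbrs; case: (boolP (adj G x y)) => //= xy.
by rewrite mem_vbox (box_trans px) // adj_box.
Qed.

Lemma sum_vbox_adjC (F : nat -> nat -> R) (p : R * R) r :
  \sum_(x <- vbox G p r) \sum_(y <- vbox G p r | adj G x y) F x y =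
  \sum_(x <- vbox G p r) \sum_(y <- vbox G p r | adj G x y) F y x.
Proof.
rewrite (exchange_big_dep xpredT) //=; apply: eq_bigr => x _.
by apply: eq_bigl => y; rewrite adj_sym.
Qed.

Definition clamp (t : R) : R := Num.max 0 (Num.min 1 t).

Lemma clamp_lip s t : (clamp s - clamp t) ^+ 2 <= (s - t) ^+ 2.
Proof.
rewrite /clamp.
have mono (x y : R) : y <= x ->
    0 <= Num.max 0 (Num.min 1 x) - Num.max 0 (Num.min 1 y) <= x - y.
  move=> yx; have [x1|x1] := leP 1 x; have [y1|y1] := leP 1 y.
  - by rewrite subrr lexx subr_ge0.
  - rewrite (max_r ler01); have [y0|y0] := leP 0 y; apply/andP; split; lra.
  - by have := lt_le_trans x1 (le_trans y1 yx); rewrite ltxx.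
  - have [x0|x0] := leP 0 x; have [y0|y0] := leP 0 y; apply/andP; split; lra.
have [st|/ltW ts] := leP t s; first by have /andP[] := mono _ _ st; nra.
rewrite -sqrrN opprB -[leRHS]sqrrN opprB; have /andP[] := mono _ _ ts; nra.
Qed.

(** The equation is tested against [eta ^ 2 * u], with a cut-off [eta] equal to 1 on the inner box,
    0 outside radius [r + g], and of slope [1 / g]. The extra 1 in the radius takes in the
    neighbours. *)
Lemma caccioppoli u (p : R * R) r g : 0 < g ->
  (forall x, laplacian G u x = 0) ->
  \sum_(x <- vbox G p r) energy u x <=
  8 * (packing (1 : R))%:R / g ^+ 2 * \sum_(x <- vbox G p (r + g + 1)) u x ^+ 2.
Proof.
move=> g0 hu; set V := vbox G p (r + g + 1).
pose eta x := clamp ((r + g - `|c x - p|) / g).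
have eta1 x : box p r (c x) -> eta x = 1.
  rewrite box_norm => h; rewrite /eta /clamp min_l ?max_r //.
  by rewrite ler_pdivlMr //; lra.
have eta0 x : ~~ box p (r + g) (c x) -> eta x = 0.
  rewrite box_norm -ltNge => h; rewrite /eta /clamp.
  have h' : (r + g - `|c x - p|) / g <= 0 by rewrite ler_pdivrMr //; lra.
  by rewrite min_r ?max_l //; lra.
have etalip x y : adj G x y -> (eta x - eta y) ^+ 2 <= (g ^+ 2)^-1.
  move=> /adj_box; rewrite box_norm => xy; apply: le_trans (clamp_lip _ _) _.
  have -> : (r + g - `|c x - p|) / g - (r + g - `|c y - p|) / g
    = (`|c y - p| - `|c x - p|) / g by field; rewrite gt_eqF.
  rewrite expr_div_n ler_pdivrMr ?exprn_gt0 // mulVf ?expf_neq0 ?gt_eqF //.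
  have : `|c y - p| <= `|c y - c x| + `|c x - p|.
    by rewrite (le_trans _ (ler_normD _ _)) // addrA subrK.
  have : `|c x - p| <= `|c y - c x| + `|c y - p|.
    by rewrite (distrC (c y) (c x)) (le_trans _ (ler_normD _ _)) // addrA subrK.
  by move=> h1 h2; nra.
pose F x y := eta x ^+ 2 * u x * (u y - u x).
have F0 : \sum_(x <- V) \sum_(y <- V | adj G x y) F x y = 0.
  rewrite big1_seq // => x _.
  have [px|px] := boolP (box p (r + g) (c x)); last first.
    by rewrite big1 // => y _; rewrite /F eta0 // expr0n !mul0r.
  by rewrite -mulr_sumr (sum_vbox_nbrs _ px) -laplacian_nbrs hu mulr0.
(* Summed over ordered pairs, both [F] terms vanish and only the error of the cut-off remains. *)
have point x y : adj G x y -> eta x ^+ 2 * (u y - u x) ^+ 2 <=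
    4 * (- (F x y + F y x)) + 4 * (g ^+ 2)^-1 * (u x ^+ 2 + u y ^+ 2).
  move=> xy; apply: (@le_trans _ _ (4 * (- (F x y + F y x))
     + 4 * (eta x - eta y) ^+ 2 * (u x ^+ 2 + u y ^+ 2))); last first.
    rewrite lerD2l ler_wpM2r ?addr_ge0 ?sqr_ge0 // ler_pM2l //; exact: etalip.
  rewrite -subr_ge0 /F; set a := eta x; set b := eta y; set P := u x; set Q := u y.
  have -> : 4 * (- (a ^+ 2 * P * (Q - P) + b ^+ 2 * Q * (P - Q))) +
     4 * (a - b) ^+ 2 * (P ^+ 2 + Q ^+ 2) - a ^+ 2 * (Q - P) ^+ 2 =
     2^-1 * ((a + b) * (P - Q) + 2 * (a - b) * (P + Q)) ^+ 2
     + 2^-1 * ((a - b) * (P - Q)) ^+ 2 + 2 * ((a - b) * (P - Q)) ^+ 2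
     + (b * (P - Q)) ^+ 2 by field.
  by rewrite !addr_ge0 ?sqr_ge0 // mulr_ge0 ?sqr_ge0 // invr_ge0.
pose S := \sum_(x <- V) u x ^+ 2.
(* [packing 1] bounds the degree of a vertex. *)
have S1 : \sum_(x <- V) \sum_(y <- V | adj G x y) u x ^+ 2 <= (packing (1 : R))%:R * S.
  rewrite mulr_sumr; apply: ler_sum => x _.
  rewrite -big_filter big_const_seq count_predT iter_addr_0 -[_ ^+ 2 *+ _]mulr_natl.
  rewrite ler_wpM2r ?sqr_ge0 // ler_nat.
  apply: (packing_bound (@center_box_sep R G) (p := c x)).
    by rewrite filter_uniq // vbox_uniq.
  by move=> y; rewrite mem_filter => /andP[/adj_box].
have S2 : \sum_(x <- V) \sum_(y <- V | adj G x y) u y ^+ 2 <= (packing (1 : R))%:R * S.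
  by rewrite sum_vbox_adjC.
have main : \sum_(x <- V) \sum_(y <- V | adj G x y) eta x ^+ 2 * (u y - u x) ^+ 2
    <= 8 * (packing (1 : R))%:R / g ^+ 2 * S.
  apply: (@le_trans _ _ (\sum_(x <- V) \sum_(y <- V | adj G x y)
    (4 * (- (F x y + F y x)) + 4 * (g ^+ 2)^-1 * (u x ^+ 2 + u y ^+ 2)))).
    by apply: ler_sum => x _; apply: ler_sum => y; exact: point.
  have -> : \sum_(x <- V) \sum_(y <- V | adj G x y)
    (4 * (- (F x y + F y x)) + 4 * (g ^+ 2)^-1 * (u x ^+ 2 + u y ^+ 2))
   = 4 * (g ^+ 2)^-1 * (\sum_(x <- V) \sum_(y <- V | adj G x y) u x ^+ 2 +
        \sum_(x <- V) \sum_(y <- V | adj G x y) u y ^+ 2).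
    under eq_bigr do rewrite big_split /= -!mulr_sumr sumrN !big_split /=.
    rewrite big_split /= -!mulr_sumr sumrN !big_split /= F0 add0r.
    by rewrite -sum_vbox_adjC F0 oppr0 mulr0 add0r.
  have -> : 8 * (packing (1 : R))%:R / g ^+ 2 * S =
    4 * (g ^+ 2)^-1 * ((packing (1 : R))%:R * S + (packing (1 : R))%:R * S).
    by field; rewrite gt_eqF.
  rewrite ler_wpM2l ?lerD // mulr_ge0 // invr_ge0 sqr_ge0 //.
apply: le_trans main.
have -> : \sum_(x <- vbox G p r) energy u x =
  \sum_(x <- vbox G p r) \sum_(y <- V | adj G x y) eta x ^+ 2 * (u y - u x) ^+ 2.
  apply: eq_big_seq => x; rewrite mem_vbox => px.
  have px' : box p (r + g) (c x) by apply: box_le px; lra.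
  rewrite (sum_vbox_nbrs _ px') eta1 // expr1n.
  by apply: eq_bigr => y _; rewrite mul1r.
apply: ler_sum_uniq; try exact: vbox_uniq.
  by move=> x; rewrite !mem_vbox; apply: box_le; lra.
by move=> x; apply: sumr_ge0 => y _; rewrite mulr_ge0 ?sqr_ge0.
Qed.

End Caccioppoli.

(** * Poincare inequality on the graph *)

Lemma natmul_sep (R : realFieldType) (L : R) (i j : nat) : 1 <= L ->
  i%:R * L - 2^-1 <= j%:R * L -> j%:R * L <= i%:R * L + 2^-1 -> i = j.
Proof.
move=> L1 h1 h2; apply/eqP; rewrite eqn_leq -(ltnS i) -(ltnS j) -!(ltr_nat R).
by rewrite -(natr1 i) -(natr1 j); apply/andP; split; nra.
Qed.

Section Poincare.
Variables (R : realType) (G : penny_graph R) (L M : R) (N : nat).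
Hypothesis cg : coarse_grid G L M N.
Hypotheses (L1 : 1 <= L) (M0 : 0 <= M).
Local Notation c := (Defs.center G).

(** The joining path stays in the box, so each of its at most [N] steps changes [u] by at most the
    square root of the energy of the box. *)
Lemma path_energy u x y : box (c x) (4 * L) (c y) ->
  (u x - u y) ^+ 2 <= N%:R ^+ 2 * \sum_(w <- vbox G (c x) M) energy G u w.
Proof.
move=> xy; have [s [ps ls sN als]] := cg.2 _ _ xy.
set E := \sum_(w <- _) _.
have E0 : 0 <= E by apply: sumr_ge0 => w _; exact: energy_ge0.
have {}als : all (fun w => energy G u w <= E) (x :: s).
  apply/allP => w /(allP als) bw.
  rewrite /E (bigD1_seq w) ?mem_vbox ?vbox_uniq //= lerDl.
  by apply: sumr_ge0 => z _; exact: energy_ge0.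
move: E E0 als => E E0 als.
have step (a b : R) : (a - b) ^+ 2 <= E -> `|a - b| <= Num.sqrt E.
  by move=> h; rewrite -sqrtr_sqr ler_wsqrtr.
have : `|u (last x s) - u x| <= (size s)%:R * Num.sqrt E.
  elim: s x {xy ls sN} ps als => [|z s IH] x /=.
    by rewrite subrr normr0 mul0r.
  move=> /andP[xz pz] /andP[xE als].
  have -> : u (last z s) - u x = (u (last z s) - u z) + (u z - u x) by ring.
  apply: le_trans (ler_normD _ _) _; rewrite -natr1 mulrDl mul1r.
  apply: lerD; first exact: IH.
  by apply: step; apply: le_trans xE; exact: adj_sqr_le_energy.
rewrite ls distrC => h; rewrite -[leLHS]real_normK ?num_real //.
rewrite -[E]sqr_sqrtr // -exprMn ler_sqr ?nnegrE ?mulr_ge0 ?sqrtr_ge0 //.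
by apply: le_trans h _; rewrite ler_wpM2r ?sqrtr_ge0 // ler_nat.
Qed.

Lemma energy_box_le u (p q : R * R) r r' : box p (r' - r) q ->
  \sum_(w <- vbox G q r) energy G u w <= \sum_(w <- vbox G p r') energy G u w.
Proof.
move=> pq; apply: ler_sum_uniq; [exact: vbox_uniq..| |exact: energy_ge0].
by move=> x; rewrite !mem_vbox => qx; apply: box_le (box_trans pq qx); lra.
Qed.

Section Lattice.
Variables (u : nat -> R) (p : R * R) (kappa h : nat) (v : nat -> nat -> nat).

(** A lattice of mesh [L], starting at a corner of the box of radius [kappa * h * L], is cut into
    [(2 * kappa)^2] blocks of [h^2] points. In [T] the first pair selects the block, the second the
    point in it. *)
Let o := (p.1 - (kappa * h)%:R * L, p.2 - (kappa * h)%:R * L).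
Let Z i j : R * R := (o.1 + i%:R * L, o.2 + j%:R * L).
Let T := ('I_(2 * kappa) * 'I_(2 * kappa) * ('I_h * 'I_h))%type.
Let row (t : T) : nat := t.1.1 * h + t.2.1.
Let col (t : T) : nat := t.1.2 * h + t.2.2.
Let E i j := \sum_(w <- vbox G (Z i j) (M + 2 * L)) energy G u w.

Hypothesis vZ : forall i j, box (Z i j) L (c (v i j)).

Lemma lattice_cell_sum i j :
  \sum_(x <- vbox G (Z i j) L) u x ^+ 2 <=
  (packing L)%:R * (2 * u (v i j) ^+ 2 + 2 * N%:R ^+ 2 * E i j).
Proof.
have l1 := L1; have m0 := M0.
have E0 : 0 <= E i j by apply: sumr_ge0 => w _; exact: energy_ge0.
apply: (@le_trans _ _ (\sum_(x <- vbox G (Z i j) L)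
    (2 * u (v i j) ^+ 2 + 2 * N%:R ^+ 2 * E i j))).
  rewrite big_seq [leRHS]big_seq; apply: ler_sum => x; rewrite mem_vbox => zx.
  have vx : box (c (v i j)) (4 * L) (c x).
    have := vZ i j; rewrite boxC => vz.
    by apply: box_le (box_trans vz zx); lra.
  have h1 : (u (v i j) - u x) ^+ 2 <= N%:R ^+ 2 * E i j.
    apply: le_trans (path_energy u vx) _; rewrite ler_wpM2l ?sqr_ge0 //.
    by apply: energy_box_le; apply: box_le (vZ i j); lra.
  (* This square is [2 * a ^ 2 + 2 * (a - b) ^ 2 - b ^ 2] with [a = u (v i j)] and [b = u x]. *)
  have := sqr_ge0 (2 * u (v i j) - u x).
  rewrite -(mulrA 2); lra.
rewrite big_const_seq count_predT iter_addr_0 -[X in X <= _]mulr_natl.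
apply: ler_wpM2r; last by rewrite ler_nat size_vbox.
by apply: addr_ge0; [|apply: mulr_ge0 => //]; apply: mulr_ge0; rewrite ?sqr_ge0.
Qed.

Lemma lattice_edge_sum i j :
  (u (v i.+1 j) - u (v i j)) ^+ 2 + (u (v i j.+1) - u (v i j)) ^+ 2 <=
  2 * N%:R ^+ 2 * E i j.
Proof.
have l1 := L1; have m0 := M0.
have H i' j' : box (Z i j) L (Z i' j') ->
    (u (v i' j') - u (v i j)) ^+ 2 <= N%:R ^+ 2 * E i j.
  move=> zz; rewrite -sqrrN opprB.
  have vv : box (c (v i j)) (4 * L) (c (v i' j')).
    have := vZ i j; rewrite boxC => vz.
    by apply: box_le (box_trans (box_trans vz zz) (vZ i' j')); lra.
  apply: le_trans (path_energy u vv) _; rewrite ler_wpM2l ?sqr_ge0 //.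
  by apply: energy_box_le; apply: box_le (vZ i j); lra.
have := H i.+1 j; have := H i j.+1.
have -> : box (Z i j) L (Z i j.+1).
  by apply/and4P; rewrite /Z /= -natr1; split; lra.
have -> : box (Z i j) L (Z i.+1 j).
  by apply/and4P; rewrite /Z /= -natr1; split; lra.
move=> /(_ isT) h1 /(_ isT) h2; rewrite -(mulrA 2); lra.
Qed.

(** Bounded overlap: a vertex contributes only to lattice points within [M + 2 * L] of it, and as
    the mesh exceeds 1/2 their number obeys the packing bound. *)
Lemma lattice_energy_sum : (0 < h)%N ->
  \sum_(t : T) E (row t) (col t) <= (packing (M + 2 * L))%:R *
    \sum_(w <- vbox G p ((kappa * h)%:R * L + (M + 2 * L))) energy G u w.
Proof.
have l1 := L1; have m0 := M0.
move=> h0; set W := vbox G p _.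
have rowlt (i : 'I_(2 * kappa)) (j : 'I_h) : (i * h + j < 2 * (kappa * h))%N.
  rewrite mulnA; apply: (@leq_trans (i.+1 * h)).
    by rewrite (mulSn i) [(h + _)%N]addnC ltn_add2l.
  by rewrite leq_mul2r ltn_ord orbT.
have inZ (t : T) : box p ((kappa * h)%:R * L) (Z (row t) (col t)).
  have H (i : nat) : (i < 2 * (kappa * h))%N ->
      0 <= i%:R * L <= 2 * ((kappa * h)%:R * L).
    move=> hi; rewrite mulr_ge0 //=; last by lra.
    by rewrite mulrA ler_wpM2r ?(le_trans _ L1) // -natrM ler_nat ltnW.
  have /andP[h1 h2] := H _ (rowlt t.1.1 t.2.1).
  have /andP[h3 h4] := H _ (rowlt t.1.2 t.2.2).
  rewrite -/(row t) in h1 h2; rewrite -/(col t) in h3 h4.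
  by apply/and4P; rewrite /Z /o /=; split; lra.
have Esum (t : T) : E (row t) (col t) =
    \sum_(w <- W | box (Z (row t) (col t)) (M + 2 * L) (c w)) energy G u w.
  rewrite -[RHS]big_filter; apply: perm_big; apply: uniq_perm.
  - exact: vbox_uniq.
  - by rewrite filter_uniq // vbox_uniq.
  move=> w; rewrite mem_filter !mem_vbox.
  case: (boolP (box (Z _ _) _ _)) => //= hw.
  by rewrite (box_trans (inZ t) hw).
under eq_bigr do rewrite Esum.
rewrite (exchange_big_dep xpredT) //= mulr_sumr; apply: ler_sum => w _.
rewrite sumr_const -[leLHS]mulr_natl ler_wpM2r ?energy_ge0 // ler_nat cardE.
apply: (packing_bound (pos := fun t : T => Z (row t) (col t)) (p := c w)).
- move=> s t; apply: contra => /and4P[z1 z2 z3 z4].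
  have er : row s = row t by
    move: z1 z2; rewrite /Z /= => z1 z2; apply: (natmul_sep L1); lra.
  have ec : col s = col t by
    move: z3 z4; rewrite /Z /= => z3 z4; apply: (natmul_sep L1); lra.
  have D (a a' : 'I_(2 * kappa)) (b b' : 'I_h) :
      (a * h + b = a' * h + b')%N -> a = a' /\ b = b'.
    move=> e; split; apply/val_inj => /=.
      have := congr1 (divn ^~ h) e; rewrite /= !divnMDl //.
      by rewrite !divn_small // !addn0.
    by have := congr1 (modn ^~ h) e; rewrite /= !modnMDl !modn_small.
  case: s t {z1 z2 z3 z4} er ec => [[s1 s2] [s3 s4]] [[t1 t2] [t3 t4]].
  by move=> /D /= [-> ->] /D /= [-> ->].
- exact: enum_uniq.
by move=> t; rewrite mem_enum => ht; rewrite boxC.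
Qed.

(** Up to energy, [u] is controlled by its values at the vertices [v i j], to which
    [square_poincare] applies block by block. The factor 6 is [2 * 2] from these values plus 2 from
    the cells, as [1 <= h]. *)
Lemma lattice_poincare r : (0 < h)%N -> r < (kappa * h)%:R * L ->
  (forall a b : 'I_(2 * kappa),
    \sum_(i < h) \sum_(j < h) u (v (a * h + i) (b * h + j)) = 0) ->
  \sum_(x <- vbox G p r) u x ^+ 2 <=
  6 * h%:R ^+ 2 * (packing L)%:R * N%:R ^+ 2 * (packing (M + 2 * L))%:R *
  \sum_(w <- vbox G p ((kappa * h)%:R * L + (M + 2 * L))) energy G u w.
Proof.
have l1 := L1; have m0 := M0.
move=> h0 rlt mean.
have L0 : 0 < L by lra.
have s1 : \sum_(x <- vbox G p r) u x ^+ 2 <=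
    \sum_(t : T) \sum_(x <- vbox G (Z (row t) (col t)) L) u x ^+ 2.
  apply: (ler_sum_cover (t := fun t : T => vbox G (Z (row t) (col t)) L)).
  - exact: vbox_uniq.
  - by move=> t; exact: vbox_uniq.
  - by move=> x; exact: sqr_ge0.
  move=> x; rewrite mem_vbox => /and4P[x1 x2 x3 x4].
  (* Each coordinate is rounded down and the index split into block and offset; the strict bound on
     [r] keeps it below [2 * kappa * h]. *)
  have H (y m : R) : m - r <= y -> y <= m + r -> exists i j : nat,
      [/\ (i < 2 * kappa)%N, (j < h)%N,
       m - (kappa * h)%:R * L + (i * h + j)%:R * L - L <= y &
       y <= m - (kappa * h)%:R * L + (i * h + j)%:R * L + L].
    move=> y1 y2; pose z := (y - (m - (kappa * h)%:R * L)) / L.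
    have z0 : 0 <= z by rewrite divr_ge0 //; lra.
    have zlt : z < (2 * (kappa * h))%:R.
      by rewrite ltr_pdivrMr // natrM; lra.
    pose i := Num.truncn z.
    have /andP[i1 i2] := truncn_itv z0; rewrite -natr1 -/i in i1 i2.
    have il : (i < 2 * (kappa * h))%N by rewrite -(ltr_nat R) (le_lt_trans i1).
    exists (i %/ h)%N, (i %% h)%N; split; last 2 first.
    - rewrite -divn_eq; move: i1; rewrite /z ler_pdivlMr //; lra.
    - rewrite -divn_eq; move: i2; rewrite /z ltr_pdivrMr //; lra.
    - by rewrite ltn_divLR // -mulnA.
    - exact: ltn_pmod.
  have [i [i' [hi hi' hx1 hx2]]] := H _ _ x1 x2.
  have [j [j' [hj hj' hy1 hy2]]] := H _ _ x3 x4.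
  exists ((Ordinal hi, Ordinal hj), (Ordinal hi', Ordinal hj')).
  by rewrite mem_vbox; apply/and4P.
have s2 : \sum_(t : T) \sum_(x <- vbox G (Z (row t) (col t)) L) u x ^+ 2 <=
   (packing L)%:R * (2 * (\sum_(t : T) u (v (row t) (col t)) ^+ 2)
      + 2 * N%:R ^+ 2 * (\sum_(t : T) E (row t) (col t))).
  rewrite !mulr_sumr -big_split /= mulr_sumr; apply: ler_sum => t _.
  exact: lattice_cell_sum.
have s3 : \sum_(t : T) u (v (row t) (col t)) ^+ 2 <=
    2 * h%:R ^+ 2 * N%:R ^+ 2 * (\sum_(t : T) E (row t) (col t)).
  rewrite -(pair_bigA _ (fun (a : 'I_(2 * kappa) * 'I_(2 * kappa)) (b : 'I_h * 'I_h)
     => u (v (a.1 * h + b.1) (a.2 * h + b.2)) ^+ 2)) /=.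
  rewrite -(pair_bigA _ (fun (a : 'I_(2 * kappa) * 'I_(2 * kappa)) (b : 'I_h * 'I_h)
     => E (a.1 * h + b.1) (a.2 * h + b.2))) /= mulr_sumr.
  apply: ler_sum => -[a b] _ /=.
  rewrite -(pair_bigA _ (fun i j : 'I_h => u (v (a * h + i) (b * h + j)) ^+ 2)).
  rewrite -(pair_bigA _ (fun i j : 'I_h => E (a * h + i) (b * h + j))) /=.
  have := @square_poincare R h (fun i j => u (v (a * h + i)%N (b * h + j)%N)) (mean a b).
  move=> /le_trans; apply.
  rewrite (mulrC 2) -!mulrA ler_wpM2l ?sqr_ge0 // !mulr_sumr.
  apply: ler_sum => i _; rewrite !mulr_sumr; apply: ler_sum => j _.
  have := lattice_edge_sum (a * h + i) (b * h + j); rewrite !addnS -!mulrA.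
  exact: ler_wpM2l.
have s4 := lattice_energy_sum h0.
set S := \sum_(t : T) E (row t) (col t) in s2 s3 s4.
have S0 : 0 <= S.
  by apply: sumr_ge0 => t _; apply: sumr_ge0 => w _; exact: energy_ge0.
have h1 : 1 <= h%:R ^+ 2 :> R by rewrite exprn_ege1 // ler1n.
apply: (le_trans s1); apply: (le_trans s2).
rewrite -[leRHS]mulrA; set B := _ * \sum_(w <- _) _ in s4 *.
have pL : 0 <= (packing L)%:R :> R by [].
have n2 : 0 <= N%:R ^+ 2 :> R by exact: sqr_ge0.
apply: (@le_trans _ _ (6 * h%:R ^+ 2 * (packing L)%:R * N%:R ^+ 2 * S)); last first.
  by rewrite ler_wpM2l // !mulr_ge0 // sqr_ge0.
have -> : 6 * h%:R ^+ 2 * (packing L)%:R * N%:R ^+ 2 * S =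
   (packing L)%:R * (2 * (2 * h%:R ^+ 2 * N%:R ^+ 2 * S)
     + 2 * N%:R ^+ 2 * (h%:R ^+ 2 * S)) by ring.
apply: ler_wpM2l => //; apply: lerD; first by rewrite ler_pM2l.
by apply: ler_wpM2l; [rewrite mulr_ge0|rewrite ler_peMl].
Qed.

End Lattice.
End Poincare.

(** * Contraction and the dimension bound *)

Section Contraction.
Variables (R : realType) (G : penny_graph R) (L M : R) (N : nat).

Definition mass (p : R * R) (r : R) (u : nat -> R) : R :=
  \sum_(x <- vbox G p r) u x ^+ 2.

Lemma mass_ge0 p r u : 0 <= mass p r u.
Proof. by apply: sumr_ge0 => x _; exact: sqr_ge0. Qed.

Lemma mass_le p r r' u : r <= r' -> mass p r u <= mass p r' u.
Proof.
move=> rr; apply: ler_sum_uniq; [exact: vbox_uniq..| |by move=> x; exact: sqr_ge0].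
by move=> x; rewrite !mem_vbox; exact: box_le.
Qed.

(** The Poincare constant times the Caccioppoli constant, [48 = 6 * 8], without their factors
    [h ^ 2] and [g ^ -2]. *)
Definition contraction_const : R :=
  48 * (packing (1 : R))%:R * (packing L)%:R * N%:R ^+ 2 * (packing (M + 2 * L))%:R.

Lemma mass_contraction (cg : coarse_grid G L M N) (u : nat -> R) (p : R * R)
    (kappa h : nat) (v : nat -> nat -> nat) (r g : R) :
  1 <= L -> 0 <= M -> (0 < h)%N -> 0 < g ->
  (forall i j, box (p.1 - (kappa * h)%:R * L + i%:R * L,
     p.2 - (kappa * h)%:R * L + j%:R * L) L (Defs.center G (v i j))) ->
  (forall x, laplacian G u x = 0) -> r < (kappa * h)%:R * L ->
  (forall a b : 'I_(2 * kappa),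
    \sum_(i < h) \sum_(j < h) u (v (a * h + i)%N (b * h + j)%N) = 0) ->
  mass p r u <= contraction_const * (h%:R / g) ^+ 2 *
    mass p ((kappa * h)%:R * L + (M + 2 * L) + g + 1) u.
Proof.
move=> L1 M0 h0 g0 hv hu hr mean.
apply: le_trans (lattice_poincare cg L1 M0 hv h0 hr mean) _.
set S := mass _ _ _; set A := 6 * _ * _ * _ * _.
have -> : contraction_const * (h%:R / g) ^+ 2 * S
   = A * (8 * (packing (1 : R))%:R / g ^+ 2 * S).
  by rewrite /contraction_const /A; field; rewrite gt_eqF.
apply: ler_wpM2l; first by rewrite /A !mulr_ge0 // sqr_ge0.
exact: caccioppoli.
Qed.

(** With [q = c0 * K * L], rounding in [h] enlarges the box by at most [q]. The lower bound on [r]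
    gives [q + (M + 2 * L) + 1 <= g], and [r + 2 * g] is [r * (1 + 1 / K)]. *)
Lemma contraction_scale (c0 K : nat) (r : R)
    (h := (Num.truncn (r / ((c0 * K)%:R * L))).+1)
    (g := r / (2 * K%:R)) :
  1 <= L -> 0 <= M -> (0 < c0)%N -> (0 < K)%N ->
  2 * K%:R * ((c0 * K)%:R * L + (M + 2 * L) + 1) <= r ->
  [/\ 0 < g, r < (c0 * K * h)%:R * L,
      (c0 * K * h)%:R * L + (M + 2 * L) + g + 1 <= r * (1 + K%:R^-1)
    & (h%:R / g) ^+ 2 <= 16 / c0%:R ^+ 2].
Proof.
move=> L1 M0 c00 K0 hr.
have c1 : 1 <= c0%:R :> R by rewrite ler1n.
have k1 : 1 <= K%:R :> R by rewrite ler1n.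
have k0 : 0 < K%:R :> R by rewrite ltr0n.
set q := (c0 * K)%:R * L.
have q1 : 1 <= q by rewrite /q natrM; apply: mulr_ege1 => //; exact: mulr_ege1.
rewrite -/q in hr.
have qr : q + (M + 2 * L) + 1 <= g.
  by rewrite /g ler_pdivlMr ?mulr_gt0 // mulrC.
have g0 : 0 < g by lra.
have rg : r = g * (2 * K%:R) by rewrite /g divfK // mulf_neq0 // gt_eqF.
have q_le_r : q <= r by rewrite rg; nra.
have q0 : 0 < q by lra.
have /andP[h1 h2] : r / q < h%:R <= r / q + 1.
  have /truncn_itv/andP[] : 0 <= r / q by rewrite divr_ge0 // ltW //; lra.
  by move=> a1 a2; rewrite /h a2 -natr1 lerD2r.
have E : (c0 * K * h)%:R * L = q * h%:R by rewrite /q !natrM; ring.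
rewrite E; split => //.
- by rewrite mulrC -ltr_pdivrMr.
- have : q * h%:R <= r + q.
    have <- : q * (r / q + 1) = r + q by field; rewrite gt_eqF.
    exact: ler_wpM2l (ltW q0) _ _ h2.
  have -> : r * (1 + K%:R^-1) = r + 2 * g.
    by rewrite /g; field; rewrite gt_eqF.
  by lra.
have hb : h%:R / g <= 4 / c0%:R.
  rewrite ler_pdivrMr // mulrAC ler_pdivlMr; last by lra.
  have h3 : h%:R <= 2 * (r / q).
    have q2 : 1 <= r / q by rewrite ler_pdivlMr // mul1r.
    by lra.
  have : c0%:R * (r / q) <= 2 * g.
    have -> : c0%:R * (r / q) = 2 * g / L.
      by rewrite rg /q natrM; field; rewrite !gt_eqF //; lra.
    by rewrite ler_pdivrMr; nra.
  move=> h4; have := ler_wpM2l (_ : 0 <= c0%:R :> R) h3.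
  by rewrite ler0n => /(_ isT); lra.
have : 0 <= h%:R / g by rewrite divr_ge0 // ltW.
have -> : 16 / c0%:R ^+ 2 = (4 / c0%:R) ^+ 2 :> R.
  by field; rewrite gt_eqF // ltr0n.
move=> h0; rewrite ler_sqr // nnegrE ?divr_ge0 //.
Qed.

End Contraction.

Lemma norm_det_le (R : realFieldType) n (A : 'M[R]_n) (B : R) :
  (forall i j, `|A i j| <= B) -> `|\det A| <= #|{perm 'I_n}|%:R * B ^+ n.
Proof.
move=> hA; apply: le_trans (ler_norm_sum _ _ _) _.
apply: (@le_trans _ _ (\sum_(s : {perm 'I_n}) B ^+ n)); last first.
  by rewrite sumr_const -[leLHS]mulr_natl.
apply: ler_sum => s _; rewrite normrM normrX normrN1 expr1n mul1r normr_prod.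
rewrite -[in leRHS](card_ord n) -prodr_const; apply: ler_prod => i _.
by rewrite normr_ge0 hA.
Qed.

(** * Gram matrices of harmonic functions *)

Section Gram.
Variables (R : realType) (G : penny_graph R) (n : nat) (b : 'I_n -> nat -> R).
Variable p : R * R.

Definition combination (a : 'rV[R]_n) (x : nat) : R := \sum_i a 0 i * b i x.

Definition gram (r : R) : 'M[R]_n :=
  \matrix_(i, j) \sum_(x <- vbox G p r) b i x * b j x.

Lemma gram_sym r : (gram r)^T = gram r.
Proof.
apply/matrixP => i j; rewrite !mxE; apply: eq_bigr => x _; exact: mulrC.
Qed.

Lemma qform_gram r a : qform (gram r) a = mass G p r (combination a).
Proof.
rewrite /qform mxE /mass.
under [RHS]eq_bigr do rewrite expr2 /combination mulr_sumr.
rewrite [RHS]exchange_big; apply: eq_bigr => j _ /=.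
rewrite !mxE mulr_suml; under [RHS]eq_bigr do rewrite mulr_suml.
rewrite [RHS]exchange_big; apply: eq_bigr => i _ /=.
rewrite mxE mulr_sumr mulr_suml; apply: eq_bigr => x _; ring.
Qed.

Lemma combination_sum (I : Type) (s : seq I) (f : I -> nat) a :
  \sum_(x <- s) combination a (f x) = \sum_i a 0 i * \sum_(x <- s) b i (f x).
Proof.
rewrite /combination exchange_big; apply: eq_bigr => i _ /=.
by rewrite mulr_sumr.
Qed.

Lemma combination_harmonic a :
  (forall i x, laplacian G (b i) x = 0) ->
  forall x, laplacian G (combination a) x = 0.
Proof.
move=> hb x; rewrite laplacian_nbrs.
under eq_bigr do rewrite /combination -sumrB.
rewrite exchange_big big1 // => i _ /=.
transitivity (a 0 i * laplacian G (b i) x); last by rewrite hb mulr0.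
rewrite laplacian_nbrs mulr_sumr; apply: eq_bigr => y _; ring.
Qed.

(** The exponent is [K] for each of the two functions, plus 2 for the number of vertices, at most
    [(4 * r + 1) ^ 2 <= 25 * r ^ 2]. *)
Lemma gram_entry_bound (L M : R) (N K : nat) (x0 : nat) :
  1 <= L -> coarse_grid G L M N -> p = Defs.center G x0 ->
  (forall i, exists C : R, forall x,
     `|b i x| <= C * (1 + (graph_dist G x x0)%:R) ^+ K) ->
  exists2 C : R, 0 <= C & forall r i j, 1 <= r ->
     `|gram r i j| <= C * r ^+ (2 * K + 2).
Proof.
move=> L1 cg ep /choice[C hC].
pose C1 := \sum_i `|C i|.
have C1ge i : C i <= C1.
  apply: le_trans (ler_norm _) _; rewrite /C1 (bigD1 i) //= lerDl.
  by apply: sumr_ge0.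
have C10 : 0 <= C1 by apply: sumr_ge0.
pose D := C1 * (3 * N%:R + 1) ^+ K.
have D0 : 0 <= D by rewrite mulr_ge0 // exprn_ge0 // addr_ge0 // mulr_ge0.
exists (25 * D ^+ 2); first by rewrite mulr_ge0 // sqr_ge0.
move=> r i j r1; have r0 : 0 <= r by lra.
have hb l x : x \in vbox G p r -> `|b l x| <= D * r ^+ K.
  rewrite mem_vbox ep => /(coarse_grid_dist L1 r1 cg) hx.
  apply: le_trans (hC l x) _.
  have d0 : 0 <= (graph_dist G x x0)%:R :> R by [].
  apply: (@le_trans _ _ (C1 * (1 + (graph_dist G x x0)%:R) ^+ K)).
    by rewrite ler_wpM2r // exprn_ge0 // addr_ge0.
  rewrite /D -mulrA ler_wpM2l // -exprMn lerXn2r ?nnegrE ?addr_ge0 //.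
    by rewrite mulr_ge0 // addr_ge0 // mulr_ge0.
  by rewrite mulrDl mul1r addrC lerD.
have D1 : 0 <= D * r ^+ K by rewrite mulr_ge0 // exprn_ge0.
rewrite mxE; apply: le_trans (ler_norm_sum _ _ _) _.
apply: (@le_trans _ _ (\sum_(x <- vbox G p r) (D * r ^+ K) ^+ 2)).
  rewrite big_seq [leRHS]big_seq; apply: ler_sum => x hx.
  by rewrite normrM expr2 ler_pM ?hb.
rewrite big_const_seq count_predT iter_addr_0 -[leLHS]mulr_natl.
have hs : (size (vbox G p r))%:R <= 25 * r ^+ 2.
  apply: (@le_trans _ _ (packing r)%:R); first by rewrite ler_nat size_vbox.
  have /truncn_itv/andP[t1 _] : 0 <= 4 * r by rewrite mulr_ge0.
  rewrite /packing natrX -natr1 -[25]/((5 * 5)%:R) natrM -expr2 -exprMn.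
  by rewrite lerXn2r ?nnegrE ?addr_ge0 ?mulr_ge0 //; lra.
apply: le_trans (ler_wpM2r (sqr_ge0 _) hs) _.
rewrite exprD exprMn -exprM mulnC le_eqVlt; apply/orP; left; apply/eqP; ring.
Qed.

End Gram.

Section DimensionBound.
Variables (R : realType) (L M : R) (N c0 : nat).

(** If [n > 2 * m], each scale gains at least a factor [X], so the positive determinant at [r0]
    would be at most [F / X ^ j] for every [j]. *)
Lemma harmonic_independent_bound (G : penny_graph R) (x0 K n : nat)
    (b : 'I_n -> nat -> R) (X := expR 4 : R) :
  1 <= L -> 0 <= M -> (0 < c0)%N -> (0 < K)%N ->
  16 * contraction_const L M N * X ^+ 2 <= c0%:R ^+ 2 ->
  coarse_grid G L M N ->
  (forall i x, laplacian G (b i) x = 0) ->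
  (forall i, exists C : R, forall x,
     `|b i x| <= C * (1 + (graph_dist G x x0)%:R) ^+ K) ->
  independent b -> (n <= 2 * (2 * (c0 * K)) ^ 2)%N.
Proof.
move=> L1 M0 c00 K0 hc0 cg hb gb ib; set m := ((2 * (c0 * K)) ^ 2)%N.
have X2 : 2 <= X by rewrite /X; have := @expR_ge1Dx R 4; lra.
have X0 : 0 < X by lra.
rewrite leqNgt; apply/negP => nm.
pose p := Defs.center G x0.
pose delta := (X ^+ 2)^-1.
have d0 : 0 <= delta <= 1.
  rewrite invr_ge0 sqr_ge0 invf_le1 ?exprn_gt0 // exprn_ege1 //; lra.
pose beta : R := 1 + K%:R^-1.
have k0 : 0 < K%:R :> R by rewrite ltr0n.
have beta1 : 1 <= beta by rewrite lerDl invr_ge0 ltW.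
have [s hs] := independent_evaluation 0%N ib.
have [rs hrs] : exists rs : R, forall x, x \in s -> box p rs (Defs.center G x).
  exists (\sum_(x <- s) `|Defs.center G x - p|) => x xs.
  rewrite box_norm (big_rem x) //= lerDl; apply: sumr_ge0 => y _.
  exact: normr_ge0.
pose rmin := 2 * K%:R * ((c0 * K)%:R * L + (M + 2 * L) + 1).
pose r0 := Num.max 1 (Num.max rs rmin).
have r01 : 1 <= r0 by rewrite le_max lexx.
have r0s : rs <= r0 by rewrite !le_max lexx orbT.
have r0m : rmin <= r0 by rewrite !le_max lexx !orbT.
have gram_pos r : r0 <= r -> forall u : 'rV_n, u != 0 -> 0 < qform (gram G b p r) u.
  move=> hr u un; rewrite qform_gram lt_def mass_ge0 andbT.
  apply: contra_neq un => /eqP; rewrite /mass psumr_eq0; last first.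
    by move=> x _; exact: sqr_ge0.
  move=> /allP h.
  apply/rowP => i; rewrite mxE; apply: (hs (fun i => u 0 i)) => j js.
  have xs := mem_nth 0%N js.
  have /h : nth 0%N s j \in vbox G p r.
    by rewrite mem_vbox; apply: box_le (hrs _ xs); apply: le_trans hr.
  by rewrite /= sqrf_eq0 => /eqP.
have step r : r0 <= r ->
    0 < \det (gram G b p r) <= delta ^+ (n - m) * \det (gram G b p (r * beta)).
  move=> hr; have hr' : rmin <= r by apply: le_trans hr.
  have [g0 rlt rle hg] := contraction_scale L1 M0 c00 K0 hr'.
  set h := (Num.truncn _).+1 in rlt rle hg; set g := r / _ in g0 rle hg.
  have [v hv] : exists v : nat -> nat -> nat, forall i j,
      box (p.1 - (c0 * K * h)%:R * L + i%:R * L,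
           p.2 - (c0 * K * h)%:R * L + j%:R * L) L (Defs.center G (v i j)).
    have /choice[f hf] : forall ij : nat * nat, exists x,
      box (p.1 - (c0 * K * h)%:R * L + ij.1%:R * L,
           p.2 - (c0 * K * h)%:R * L + ij.2%:R * L) L (Defs.center G x).
      by move=> ij; apply: cg.1.
    by exists (fun i j => f (i, j)) => i j; apply: (hf (i, j)).
  pose I := ('I_(2 * (c0 * K)) * 'I_(2 * (c0 * K)))%type.
  have cI : #|{: I}| = m by rewrite card_prod card_ord /m expnS expn1.
  pose bsum i (z : I) :=
    \sum_(j < h) \sum_(k < h) b i (v (z.1 * h + j)%N (z.2 * h + k)%N).
  (* [u *m Kmx = 0] says that the combination has zero mean on each of the [m] blocks. *)
  pose Kmx : 'M[R]_(n, #|{: I}|) := \matrix_(i, t) bsum i (enum_val t).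
  rewrite -cI; apply: (det_le_kernel (K := Kmx)) => //.
  - exact: gram_sym.
  - exact: gram_sym.
  - exact: gram_pos.
  - by move=> u; rewrite !qform_gram mass_le // ler_peMr //; lra.
  move=> u hu; rewrite !qform_gram.
  have mean (a a' : 'I_(2 * (c0 * K))) : \sum_(j < h) \sum_(k < h)
      combination b u (v (a * h + j)%N (a' * h + k)%N) = 0.
    have := congr1 (fun w : 'rV_#|{: I}| => w 0 (enum_rank (a, a'))) hu.
    rewrite !mxE => e; rewrite -[RHS]e.
    rewrite (eq_bigr (fun j : 'I_h => \sum_i u 0 i *
        \sum_(k < h) b i (v (a * h + j)%N (a' * h + k)%N))); last first.
      by move=> j _; rewrite combination_sum.
    rewrite exchange_big; apply: eq_bigr => i _ /=.
    by rewrite mxE enum_rankK /= -mulr_sumr.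
  have := mass_contraction cg L1 M0 (ltn0Sn _) g0 hv
    (combination_harmonic u hb) rlt mean.
  move=> /le_trans; apply.
  apply: ler_pM; [|exact: mass_ge0| |exact: mass_le].
    by rewrite mulr_ge0 ?sqr_ge0 // /contraction_const !mulr_ge0 // sqr_ge0.
  have cc0 : 0 <= contraction_const L M N.
    by rewrite /contraction_const !mulr_ge0 // sqr_ge0.
  apply: le_trans (ler_wpM2l cc0 hg) _.
  rewrite /delta -[leRHS]mul1r ler_pdivlMr ?exprn_gt0 //.
  have -> : contraction_const L M N * (16 / c0%:R ^+ 2) * X ^+ 2 =
      16 * contraction_const L M N * X ^+ 2 / c0%:R ^+ 2.
    by field; rewrite pnatr_eq0 -lt0n.
  by rewrite ler_pdivrMr ?mul1r // exprn_gt0 // ltr0n.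
have iter j : 0 < \det (gram G b p r0) <=
    (delta ^+ (n - m)) ^+ j * \det (gram G b p (r0 * beta ^+ j)).
  have rj (i : nat) : r0 <= r0 * beta ^+ i.
    by rewrite ler_peMr ?exprn_ege1 //; lra.
  elim: j => [|j /andP[IH0 IH]].
    have := step _ (lexx r0); rewrite !expr0 mul1r mulr1 => /andP[-> _].
    exact: lexx.
  rewrite IH0; apply: le_trans IH _; rewrite exprSr -mulrA.
  rewrite ler_wpM2l ?exprn_ge0 //; first by case/andP: d0.
  by have /andP[_] := step _ (rj j); rewrite -mulrA -exprSr.
have [C C0 hC] := gram_entry_bound (K := K) L1 cg (erefl p) gb.
set d := \det (gram G b p r0) in iter.
have dpos : 0 < d by have /andP[] := iter 0%N.
(* [(1 + 1 / K) ^ (2 * K + 2)] is at most the exponential of [2 + 2 / K <= 4]. *)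
have betaX : beta ^+ (2 * K + 2) <= X.
  have h1 : beta <= expR K%:R^-1 by exact: expR_ge1Dx.
  apply: (@le_trans _ _ (expR K%:R^-1 ^+ (2 * K + 2))).
    by rewrite lerXn2r ?nnegrE ?expR_ge0 //; lra.
  rewrite -expRM_natl ler_expR ler_pdivrMr // -natrM ler_nat.
  by rewrite -[4%N]/(2 + 2)%N mulnDl leq_add2l leq_pmulr.
pose F := #|{perm 'I_n}|%:R * (C * r0 ^+ (2 * K + 2)) ^+ n.
have F0 : 0 <= F by rewrite mulr_ge0 // exprn_ge0 // mulr_ge0 // exprn_ge0; lra.
have key j : X ^+ j * d <= F.
  have /andP[_ h1] := iter j.
  have rj : 1 <= r0 * beta ^+ j.
    by rewrite mulr_ege1 // exprn_ege1.
  have h2 : \det (gram G b p (r0 * beta ^+ j)) <= F * (X ^+ n) ^+ j.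
    apply: le_trans (ler_norm _) _.
    apply: le_trans (norm_det_le (fun i k => hC _ i k rj)) _.
    rewrite /F -mulrA ler_wpM2l //.
    have -> : (X ^+ n) ^+ j = (X ^+ j) ^+ n by rewrite -!exprM mulnC.
    rewrite -exprMn.
    have r0p : 0 <= r0 by lra.
    have rjp : 0 <= r0 * beta ^+ j by lra.
    rewrite lerXn2r ?nnegrE ?mulr_ge0 ?exprn_ge0 //; try lra.
    rewrite -mulrA ler_wpM2l // exprMn ler_wpM2l ?exprn_ge0 //.
    have -> : (beta ^+ j) ^+ (2 * K + 2) = (beta ^+ (2 * K + 2)) ^+ j.
      by rewrite -!exprM mulnC.
    rewrite lerXn2r ?nnegrE ?exprn_ge0 //; lra.
  have h3 : d <= (delta ^+ (n - m) * X ^+ n) ^+ j * F.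
    apply: le_trans h1 _; rewrite exprMn -mulrA [_ * F]mulrC ler_wpM2l //.
    by rewrite !exprn_ge0 //; case/andP: d0.
  (* The total exponent of [X] is [1 + n - 2 * (n - m)], which is at most 0 because [2 * m < n]. *)
  have h4 : X * (delta ^+ (n - m) * X ^+ n) <= 1.
    rewrite /delta exprVn -exprM mulrCA mulrC -exprS.
    rewrite ler_pdivrMr ?exprn_gt0 // mul1r ler_weXn2l //; first lra.
    by rewrite mulnBr ltn_subRL [(2 * n)%N]mul2n -addnn ltn_add2r.
  have e0 : 0 <= delta ^+ (n - m) * X ^+ n.
    by rewrite mulr_ge0 ?exprn_ge0 //; [case/andP: d0|lra].
  apply: (@le_trans _ _ ((X * (delta ^+ (n - m) * X ^+ n)) ^+ j * F)).
    by rewrite exprMn -mulrA ler_wpM2l // exprn_ge0 //; lra.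
  rewrite -[leRHS]mul1r ler_wpM2r // exprn_ile1 // mulr_ge0 //; lra.
pose j := (Num.truncn (F / d)).+1.
have h1 : F < j%:R * d by rewrite -ltr_pdivrMr // truncnS_gt.
have h2 : j%:R <= X ^+ j.
  apply: (@le_trans _ _ (2 ^+ j)); last by rewrite lerXn2r ?nnegrE //; lra.
  by rewrite -natrX ler_nat ltnW // ltn_expl.
have := key j; apply/negP; rewrite -ltNge; apply: lt_le_trans h1 _.
by rewrite ler_wpM2r // ltW.
Qed.

End DimensionBound.

Unset Implicit Arguments.

Theorem corollary3p10 (R : realType) (D : R) :
  exists C : R, forall G : penny_graph R,
    graph_connected G ->
    (forall sigma : set (R * R), faces G sigma -> (facial_degree G sigma <= D%:E)%E) ->
    forall (x0 : nat) (k : R), 1 <= k ->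
      (dimension (harmonic_growth G x0 k) <= (C * k ^+ 2)%:E)%E.
Proof.
pose L := face_radius D; pose M := 6 * L + 5; pose N := packing M.
have L1 : 1 <= L.
  have : 1 <= (Num.truncn D).+1%:R :> R by rewrite ler1n.
  by rewrite /L /face_radius; lra.
have M0 : 0 <= M by rewrite /M; lra.
(* Makes [contraction_const * 16 / c0 ^ 2] at most [delta], since [c0 <= c0 ^ 2]. *)
pose c0 := (Num.truncn (16 * contraction_const L M N * expR 4 ^+ 2)).+1.
have hc0 : 16 * contraction_const L M N * expR 4 ^+ 2 <= c0%:R ^+ 2.
  apply: (@le_trans _ _ c0%:R); first by rewrite ltW // truncnS_gt.
  by rewrite expr2 ler_peMr // ler1n.
(* The value of [2 * (2 * c0 * K) ^ 2] at [K = 2 * k], divided by [k ^ 2]. *)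
exists (32 * c0%:R ^+ 2) => G cG hD x0 k k1.
have cg : coarse_grid G L M N by exact: bounded_faces_coarse_grid.
(* An integer exponent above [k]; [1 <= k] gives [K <= k + 1 <= 2 * k]. *)
pose K := (Num.truncn k).+1.
have kK : k <= K%:R by rewrite ltW // truncnS_gt.
have Kk : K%:R <= 2 * k.
  have /truncn_itv/andP[h1 _] : 0 <= k by lra.
  by rewrite /K -natr1; lra.
apply: (@le_trans _ _ (((2 * (2 * (c0 * K)) ^ 2)%N)%:R)%:E); last first.
  rewrite lee_fin natrM natrX !natrM.
  have -> : 32 * c0%:R ^+ 2 * k ^+ 2 = 2 * (2 * (c0%:R * (2 * k))) ^+ 2 :> R by ring.
  rewrite ler_pM2l // lerXn2r ?nnegrE ?mulr_ge0 //; try lra.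
  by rewrite ler_pM2l // ler_wpM2l.
apply: dimension_le => n b hW ib.
apply: (harmonic_independent_bound (x0 := x0) (b := b) L1 M0 _ _ hc0 cg) => //.
  by move=> i; have [] := hW i.
(* The base is at least 1, so the exponent may rise from [k] to [K] once the constant is visibly
   nonnegative. *)
move=> i; have [_ [C hC]] := hW i; exists `|C| => x.
have d1 : 1 <= 1 + (graph_dist G x x0)%:R :> R by rewrite lerDl.
apply: le_trans (hC x) _.
apply: (@le_trans _ _ (`|C| * (1 + (graph_dist G x x0)%:R) `^ k)).
  by rewrite ler_wpM2r ?powR_ge0 // ler_norm.
rewrite ler_wpM2l // -powR_mulrn; last by lra.
exact: ler_powR.
Qed.
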